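(* Let $\Omega\subseteq\mathbb{R}^n$ be open and assume that $\Omega$ is bounded in one dimension; that is, there exist a vector $x\in\mathbb{R}^n$ with $\|x\|=1$ and a number $m>0$ such that $$\Omega\subseteq\{y\in\mathbb{R}^n : |\langle y,x\rangle|\le m\}.$$ Then $\operatorname{ran}(\operatorname{grad}^{\#})$ is closed and $\operatorname{grad}^{\#}=-\left(\operatorname{div}^{\#}\right)^{\ast}$. Moreover, if $\Omega$ is bounded, then the embeddings $D_{(\operatorname{grad}^{\#})_{\mathrm{red}}}\hookrightarrow L_2(\Omega)$ and $D_{(\operatorname{div}^{\#})_{\mathrm{red}}}\hookrightarrow L_2(\Omega)^n$ are compact.
   Context: Let $\operatorname{grad}_c\colon C_c^\infty(\Omega)\subseteq L_2(\Omega)\to L_2(\Omega)^n$, $\phi\mapsto(\partial_j\phi)_{j\in\{1,\dots,n\}}$, and $\operatorname{div}_c\colon C_c^\infty(\Omega)^n\subseteq L_2(\Omega)^n\to L_2(\Omega)$, $\Psi\mapsto\sum_{j=1}^n\partial_j\Psi_j$, where $C_c^\infty(\Omega)$ is the space of compactly supported infinitely differentiable functions on $\Omega$. Both are closable; put $\operatorname{grad}_0=\overline{\operatorname{grad}_c}$, $\operatorname{div}_0=\overline{\operatorname{div}_c}$ (closures), $\operatorname{grad}=-\operatorname{div}_0^{\ast}$ (with domain $H^1(\Omega)$) and $\operatorname{div}=-\operatorname{grad}_0^{\ast}$ (with domain $\{\Psi\in L_2(\Omega)^n : \sum_j\partial_j\Psi_j\in L_2(\Omega)\}$, derivatives in the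 distributional sense). The operators $\operatorname{grad}^{\#}\subseteq\operatorname{grad}$ and $\operatorname{div}^{\#}\subseteq\operatorname{div}$ are the restrictions to $$\operatorname{dom}(\operatorname{grad}^{\#})=\{u\in\operatorname{dom}(\operatorname{grad}) : \operatorname{grad}u\in\overline{\operatorname{ran}}(\operatorname{grad}_0)\},\quad \operatorname{dom}(\operatorname{div}^{\#})=\{\Psi\in\operatorname{dom}(\operatorname{div}) : \operatorname{div}\Psi\in\overline{\operatorname{ran}}(\operatorname{div}_0)\},$$ where $\overline{\operatorname{ran}}$ denotes the closure of the range. For a closed densely defined linear operator $T\colon\operatorname{dom}(T)\subseteq X\to Y$ between Hilbert spaces, the reduced operator is $T_{\mathrm{red}}\colon\operatorname{dom}(T)\cap\ker(T)^\perp\subseteq\ker(T)^\perp\to\overline{\operatorname{ran}}(T)$, $x\mapsto Tx$, and $D_{T_{\mathrm{red}}}=\operatorname{dom}(T)\cap\ker(T)^\perp$ equipped with the graph norm of $T_{\mathrm{red}}$. *)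

(* Defs.v *)
From HB Require Import structures.
From mathcomp Require Import all_boot all_order all_algebra.
From mathcomp Require Import all_classical all_reals all_analysis.
From mathcomp Require Import measurable_realfun ring lra.

Set Implicit Arguments.
Unset Strict Implicit.
Unset Printing Implicit Defensive.
Import Order.TTheory GRing.Theory Num.Theory.
Import numFieldNormedType.Exports.
Local Open Scope classical_set_scope.
Local Open Scope ring_scope.

(* The product (= Borel) sigma-algebra of R^n, generated by the coordinates *)
(* as for [n.-tuple R] in the library.                                      *)
Definition rV_display : measure_display.
Proof. exact: default_measure_display. Qed.

Section measurable_rV.
Context (R : realType) (n : nat).

Let coord : 'I_n -> 'rV[R]_n -> R := fun i x => x 0 i.

Let rV_set0 : g_sigma_preimage coord set0.
Proof. exact: sigma_algebra0. Qed.

Let rV_setC A : g_sigma_preimage coord A -> g_sigma_preimage coord (~` A).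
Proof. exact: sigma_algebraC. Qed.

Let rV_bigcup (F : _^nat) : (forall i, g_sigma_preimage coord (F i)) ->
  g_sigma_preimage coord (\bigcup_i (F i)).
Proof. exact: sigma_algebra_bigcup. Qed.

HB.instance Definition _ := @isMeasurable.Build rV_display
  'rV[R]_n (g_sigma_preimage coord) rV_set0 rV_setC rV_bigcup.

Lemma measurable_coord (i : 'I_n) :
  measurable_fun [set: 'rV[R]_n] (fun x : 'rV[R]_n => x 0 i).
Proof.
move=> _ Y mY; rewrite setTI; apply: sub_sigma_algebra => /=.
rewrite -bigcup_seq/=; exists i => /=; first by rewrite mem_index_enum.
by exists Y => //; rewrite setTI.
Qed.

Lemma measurable_fun_rV d (T : measurableType d) (f : T -> 'rV[R]_n) :
  (forall i, measurable_fun [set: T] (fun t => f t 0 i)) ->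
  measurable_fun [set: T] f.
Proof.
move=> mf _ Y mY; rewrite setTI; move: Y mY.
apply: smallest_sub => /=.
  split=> [|A mA|F mF] /=.
  - by rewrite preimage_set0.
  - by rewrite setTD -preimage_setC; exact: measurableC.
  - by rewrite preimage_bigcup; exact: bigcupT_measurable.
rewrite -bigcup_seq => Y [i _ [B mB <-]].
by rewrite setTI -[X in measurable X]setTI; exact: (mf i).
Qed.

Lemma open_measurable_rV (O : set 'rV[R]_n) : open O -> measurable O.
Proof.
move=> oO.
pose q (p : 'rV[rat]_n * nat) : set 'rV[R]_n :=
  [set x | forall i, `|ratr (p.1 0 i) - x 0 i| < p.2.+1%:R^-1].
have -> : O = \bigcup_(p in [set p | q p `<=` O]) q p.
  apply/seteqP; split=> [x Ox|x [p pO]]; last exact: pO.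
  have /nbhs_ballP[e/= e0 eO] := open_nbhs_nbhs (conj oO Ox).
  have [k _ /(_ _ (leqnn _))/= ke] := near_infty_natSinv_lt (PosNum (divr_gt0 e0 (ltr0Sn R 1))).
  have dr i : {r : rat | `|ratr r - x 0 i| < k.+1%:R^-1}.
    have : x 0 i - k.+1%:R^-1 < x 0 i + k.+1%:R^-1.
      by rewrite ltrD2l gtrN// invr_gt0.
    by move=> /rat_in_itvoo/cid[r]; rewrite in_itv/= -ltr_distlC distrC; exists r.
  exists (\row_i sval (dr i), k); last first.
    by move=> i/=; rewrite mxE; case: (dr i).
  move=> y yq; apply: eO; split => // i0 i; rewrite (ord1 i0).
  rewrite /ball/=.
  have := yq i; rewrite /= mxE; case: (dr i) => r/= rx ry.
  rewrite (le_lt_trans (ler_distD (ratr r) _ _))// (splitr e).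
  by rewrite ltrD// distrC ?(lt_trans rx)// distrC (lt_trans ry).
rewrite (_ : \bigcup_(p in _) _ = \bigcup_(k in [set: nat])
    (if unpickle k is Some p then if `[<q p `<=` O>] then q p else set0 else set0)); last first.
  apply/seteqP; split=> x.
    by move=> [p /= pO qpx]; exists (pickle p) => //; rewrite pickleK asboolT.
  move=> [k _]; case: (unpickle k) => // p; case: asboolP => // qO qx.
  by exists p.
apply: bigcupT_measurable => k; case: (unpickle k) => // p; case: asboolP => // _.
rewrite (_ : q p = \bigcap_(i in [set: 'I_n]) [set x : 'rV[R]_n |
    `|ratr (p.1 0 i) - x 0 i| < p.2.+1%:R^-1]); last first.
  by apply/seteqP; split=> [x qx i _|x qx i]; exact: qx.
apply: fin_bigcap_measurable => // i _; rewrite -[X in measurable X]setTI.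
rewrite (_ : [set _ | _] = (fun x : 'rV[R]_n => x 0 i) @^-1`
    ball (ratr (p.1 0 i) : R) p.2.+1%:R^-1); last by [].
by apply: measurable_coord => //; exact: measurable_ball.
Qed.

End measurable_rV.

Section lebesgue_step.
Context (R : realType) (n : nat).

Definition rV_cons (p : measurableTypeR R * 'rV[R]_n) : 'rV[R]_n.+1 :=
  row_mx (p.1)%:M p.2 : 'rV_(1 + n).

Lemma rV_cons0 p : rV_cons p 0 0 = p.1.
Proof.
have -> : (0 : 'I_n.+1) = lshift n (0 : 'I_1) by exact/val_inj.
by apply: etrans (row_mxEl _ _ _ _) _; rewrite mxE eqxx mulr1n.
Qed.

Lemma rV_consS p (i : 'I_n) : rV_cons p 0 (lift 0 i) = p.2 0 i.
Proof.
have -> : lift (0 : 'I_n.+1) i = rshift 1 i by exact/val_inj.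
exact: (row_mxEr _ _ _ _).
Qed.

Lemma measurable_rV_cons : measurable_fun [set: measurableTypeR R * 'rV[R]_n] rV_cons.
Proof.
apply: measurable_fun_rV => i; case: (unliftP 0 i) => [j|] ->.
  apply: (eq_measurable_fun (fun p : measurableTypeR R * 'rV[R]_n => p.2 0 j)).
    by move=> p _; rewrite rV_consS.
  exact: (measurableT_comp (measurable_coord j) measurable_snd).
apply: (eq_measurable_fun fst) => // p _.
by rewrite rV_cons0.
Qed.

Context (mu : {sigma_finite_measure set 'rV[R]_n -> \bar R}).

Definition lebesgue_rV_step : set 'rV[R]_n.+1 -> \bar R :=
  pushforward (lebesgue_measure \x mu)%E rV_cons.

Let step0 : lebesgue_rV_step set0 = 0%E.
Proof. by rewrite /lebesgue_rV_step /pushforward preimage_set0 measure0. Qed.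

Let step_ge0 A : (0 <= lebesgue_rV_step A)%E.
Proof. by apply: measure_ge0; exact: measurable_rV_cons. Qed.

Let step_sigma_additive : semi_sigma_additive lebesgue_rV_step.
Proof.
apply: measure_semi_sigma_additive; exact: measurable_rV_cons.
Qed.

HB.instance Definition _ := isMeasure.Build _ _ _ lebesgue_rV_step
  step0 step_ge0 step_sigma_additive.

Let step_sigma_finite : sigma_finite [set: 'rV[R]_n.+1] lebesgue_rV_step.
Proof.
pose g (x : 'rV[R]_n.+1) : measurableTypeR R * 'rV[R]_n :=
  (x 0 0, \row_i x 0 (lift 0 i)).
have mg : measurable_fun [set: 'rV[R]_n.+1] g.
  apply: measurable_fun_pair => /=; first exact: measurable_coord.
  apply: measurable_fun_rV => i; under eq_fun do rewrite mxE.
  exact: measurable_coord.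
have gK p : g (rV_cons p) = p.
  rewrite /g rV_cons0 [RHS]surjective_pairing; congr pair.
  by apply/rowP => i; rewrite mxE rV_consS.
have /sigma_finiteP[F [TF ndF Foo]] := sigma_finiteT (@lebesgue_measure R).
have /sigma_finiteP[G [TG ndG Goo]] := sigma_finiteT mu.
exists (fun k => g @^-1` (F k `*` G k)).
  rewrite -preimage_bigcup -[LHS](preimage_setT g); congr (_ @^-1` _).
  rewrite -setXTT TF TG predeqE => -[x y]; split.
    move=> [/= [k _ Fkx] [l _ Gly]]; exists (maxn k l) => //; split.
    - by move: x Fkx; exact/subsetPset/ndF/leq_maxl.
    - by move: y Gly; exact/subsetPset/ndG/leq_maxr.
  by move=> [k _ []/= ? ?]; split; exists k.
move=> k; have [mF ?] := Foo k; have [mG ?] := Goo k; split.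
  by rewrite -[X in measurable X]setTI; apply: mg => //; exact: measurableX.
rewrite /lebesgue_rV_step /pushforward -comp_preimage.
rewrite (_ : g \o rV_cons = id); last by apply/funext => p /=; rewrite gK.
rewrite preimage_id product_measure1E// lte_mul_pinfty// ge0_fin_numE//.
Qed.

HB.instance Definition _ := Measure_isSigmaFinite.Build _ _ _
  lebesgue_rV_step step_sigma_finite.
End lebesgue_step.

Fixpoint lebesgue_rV (R : realType) (n : nat) :
    {sigma_finite_measure set 'rV[R]_n -> \bar R} :=
  if n is m.+1 then lebesgue_rV_step (lebesgue_rV R m) else \d_(0 : 'rV[R]_0).

Arguments lebesgue_rV R n : clear implicits.

Lemma lebesgue_rV_box (R : realType) (n : nat) (A : 'I_n -> set R) :
  (forall i, measurable (A i)) ->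
  lebesgue_rV R n [set x | forall i, A i (x 0 i)] =
  (\prod_(i < n) lebesgue_measure (A i))%E.
Proof.
elim: n A => [|n IH] A mA.
  by rewrite big_ord0 /= diracE mem_set// => -[].
pose B := [set x : 'rV[R]_n | forall i, A (lift 0 i) (x 0 i)].
have mB : measurable B.
  rewrite (_ : B = \bigcap_(i in [set: 'I_n])
      ((fun x : 'rV[R]_n => x 0 i) @^-1` A (lift 0 i))); last first.
    by apply/seteqP; split=> [x Bx i _|x Bx i]; exact: Bx.
  apply: fin_bigcap_measurable => // i _; rewrite -[X in measurable X]setTI.
  exact: measurable_coord.
rewrite big_ord_recl -IH//= /lebesgue_rV_step /pushforward.
rewrite (_ : _ @^-1` _ = A 0 `*` B) ?product_measure1E//; first exact: mA.
apply/seteqP; split=> [p Ap|p [A0 AB] i] /=.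
  split=> [|i]; first by rewrite -rV_cons0; exact: Ap.
  by rewrite -rV_consS; exact: Ap.
by case: (unliftP 0 i) => [j|] ->; rewrite ?rV_consS ?rV_cons0//; exact: AB.
Qed.

HB.mixin Record NormedModule_isInnerProduct (R : realType) V
    & NormedModule R V := {
  inner : V -> V -> R;
  innerC : forall x y, inner x y = inner y x;
  innerDl : forall x y z, inner (x + y) z = inner x z + inner y z;
  innerZl : forall a x y, inner (a *: x) y = a * inner x y;
  inner_norm : forall x, inner x x = `|x| ^+ 2
}.

#[short(type=innerProductType)]
HB.structure Definition InnerProduct (R : realType) :=
  {V of NormedModule_isInnerProduct R V & NormedModule R V}.

HB.factory Record Lmodule_isInnerProduct (R : realType) V & GRing.Lmodule R V := {
  dot : V -> V -> R;
  dotC : forall x y, dot x y = dot y x;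
  dotDl : forall x y z, dot (x + y) z = dot x z + dot y z;
  dotZl : forall a x y, dot (a *: x) y = a * dot x y;
  dot_ge0 : forall x, 0 <= dot x x;
  dot_eq0 : forall x, dot x x = 0 -> x = 0
}.

HB.builders Context R V & Lmodule_isInnerProduct R V.

Let nrm x := Num.sqrt (dot x x).

Let dotDr x y z : dot x (y + z) = dot x y + dot x z.
Proof. by rewrite dotC dotDl !(dotC _ x). Qed.

Let dotZr a x y : dot x (a *: y) = a * dot x y.
Proof. by rewrite dotC dotZl dotC. Qed.

Let dotDD x y a : dot (x + a *: y) (x + a *: y) =
  dot x x + a * dot x y *+ 2 + a ^+ 2 * dot y y.
Proof. by rewrite !(dotDl, dotDr, dotZl, dotZr) (dotC y x); ring. Qed.

Let CS x y : dot x y ^+ 2 <= dot x x * dot y y.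
Proof.
have [/dot_eq0 y0|y0] := eqVneq (dot y y) 0.
  have -> : dot x y = 0 by rewrite y0 -(scale0r y) dotZr mul0r.
  by rewrite expr0n mulr_ge0 ?dot_ge0.
have yp : 0 < dot y y by rewrite lt_neqAle eq_sym y0 dot_ge0.
have := dot_ge0 (x + (- (dot x y / dot y y)) *: y).
rewrite dotDD -(pmulr_rge0 _ yp) -[dot x y ^+ 2 <= _]subr_ge0.
by rewrite (_ : dot y y * _ = dot x x * dot y y - dot x y ^+ 2)//; field.
Qed.

Let nrmD x y : nrm (x + y) <= nrm x + nrm y.
Proof.
rewrite -(@ler_pXn2r _ 2) ?nnegrE ?addr_ge0 ?sqrtr_ge0// sqrrD.
rewrite !sqr_sqrtr ?dot_ge0// -{1 2}(scale1r y) dotDD expr1n !mul1r.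
rewrite lerD2r lerD2l ler_wMn2r//.
rewrite -sqrtrM ?dot_ge0// (le_trans (ler_norm _))//.
by rewrite -sqrtr_sqr ler_wsqrtr// CS.
Qed.

Let nrmZ a x : nrm (a *: x) = `|a| * nrm x.
Proof.
by rewrite /nrm dotZl dotZr mulrA -expr2 sqrtrM ?sqr_ge0// sqrtr_sqr.
Qed.

Let nrm_eq0 x : nrm x = 0 -> x = 0.
Proof.
move=> /eqP; rewrite sqrtr_eq0 => x0; apply: dot_eq0; apply/eqP.
by rewrite eq_le x0 dot_ge0.
Qed.

HB.instance Definition _ := Lmodule_isNormed.Build R V nrmD nrmZ nrm_eq0.

Let dot_norm x : dot x x = `|x| ^+ 2.
Proof. by rewrite sqr_sqrtr ?dot_ge0. Qed.

HB.instance Definition _ := NormedModule_isInnerProduct.Build R V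
  dotC dotDl dotZl dot_norm.

HB.end.

Section ffun_inner.
Context (R : realType) (V : innerProductType R) (n : nat).

Let fdot (f g : {ffun 'I_n -> V}) : R := \sum_i inner (f i) (g i).

Let fdotC f g : fdot f g = fdot g f.
Proof. by apply: eq_bigr => i _; rewrite innerC. Qed.

Let fdotDl f g h : fdot (f + g) h = fdot f h + fdot g h.
Proof. by rewrite -big_split; apply: eq_bigr => i _; rewrite ffunE innerDl. Qed.

Let fdotZl a f g : fdot (a *: f) g = a * fdot f g.
Proof. by rewrite mulr_sumr; apply: eq_bigr => i _; rewrite ffunE innerZl. Qed.

Let inner_ge0 (x : V) : 0 <= inner x x.
Proof. by rewrite inner_norm sqr_ge0. Qed.

Let fdot_ge0 f : 0 <= fdot f f.
Proof. by apply: sumr_ge0 => i _. Qed.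

Let fdot_eq0 f : fdot f f = 0 -> f = 0.
Proof.
move=> /eqP; rewrite psumr_eq0// => /allP f0; apply/ffunP => i.
have := f0 i (mem_index_enum _).
by rewrite inner_norm expf_eq0/= normr_eq0 ffunE => /eqP.
Qed.

HB.instance Definition _ := Lmodule_isInnerProduct.Build R {ffun 'I_n -> V}
  fdotC fdotDl fdotZl fdot_ge0 fdot_eq0.
End ffun_inner.


Lemma filterS4 (I : Type) (F : set_system I) {FF : Filter F} (P1 P2 P3 P4 Q : set I) :
  (forall x, P1 x -> P2 x -> P3 x -> P4 x -> Q x) ->
  F P1 -> F P2 -> F P3 -> F P4 -> F Q.
Proof.
move=> PQ F1 F2 F3 F4; apply: filterS2 (filterI F1 F2) (filterI F3 F4).
by move=> x [? ?] [? ?]; exact: PQ.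
Qed.

Section L2.
Context d (T : measurableType d) (R : realType).
Variable mu : {measure set T -> \bar R}.

Local Notation L2 := (LspaceType2 mu).
Implicit Types (f g : T -> R) (u v w : L2).

HB.instance Definition _ := gen_eqMixin L2.
HB.instance Definition _ := gen_choiceMixin L2.

Definition L2fun u : T -> R := u.

Lemma Lfun_ae f g : f = g %[ae mu] -> measurable_fun setT g ->
  f \in Lfun mu 2%:E -> g \in Lfun mu 2%:E.
Proof.
move=> fg mg; rewrite !inE => /andP[/[!inE]/= mf nf]; apply/andP; split; rewrite inE//=.
rewrite /finite_norm (le_lt_trans _ nf)//.
rewrite unlock /Lnorm le_eqVlt; apply/orP; left; apply/eqP; congr (_ `^ _)%E.
apply: ae_eq_integral => //.
- apply/measurable_EFinP/(@measurableT_comp _ _ _ _ _ _ (fun x : R => x `^ 2)%R) => //.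
  exact/measurableT_comp.
- apply/measurable_EFinP/(@measurableT_comp _ _ _ _ _ _ (fun x : R => x `^ 2)%R) => //.
  exact/measurableT_comp.
by apply: filterS fg => x /[apply] /= ->.
Qed.

Lemma L2funP u : L2fun u \in Lfun mu 2%:E.
Proof.
case: u => c [[h]]; apply/andP; split; rewrite inE//=.
rewrite /L2fun/=. exact: (@measurable_funPT _ _ _ _ (repr c)).
Qed.

Lemma L2fun_inj u v : L2fun u = L2fun v %[ae mu] -> u = v.
Proof.
case: u => c [[hc]]; case: v => e [[he]]; rewrite /L2fun/= => ce.
have ce' : c = e.
  rewrite -(reprK c) -(reprK e); apply/eqP.
  by rewrite eqmodE; apply/asboolP.
by case: _ / ce' in he ce *; rewrite (Prop_irrelevance hc he).
Qed.

Lemma toL2_key f : f \in Lfun mu 2%:E -> {u : L2 | L2fun u = f %[ae mu]}.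
Proof.
move=> fL; have /andP[/[!inE]/= mf _] := fL.
pose F : {mfun T >-> measurableTypeR R} := HB.pack f (isMeasurableFun.Build _ _ _ (measurableTypeR R) f mf).
pose c : {mfun_ mu, T >-> measurableTypeR R} := (\pi F)%qT.
have cf : (c : T -> R) = f %[ae mu].
  have /asboolP : ae_eq_op mu (repr c) F by rewrite -eqmodE reprK.
  by [].
have cL : finite_norm mu 2%:E c.
  have /andP[_ /[!inE]//] : (c : T -> R) \in Lfun mu 2%:E.
  apply: Lfun_ae fL; first exact: ae_eq_sym.
  exact: (@measurable_funPT _ _ _ _ (repr c)).
pose u : L2 := HB.pack c (isFinLebesgue.Build _ _ _ _ _ (lee1n 2) c cL).
by exists u.
Qed.

Definition toL2 f (fL : f \in Lfun mu 2%:E) : L2 := sval (toL2_key fL).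

Lemma toL2K f (fL : f \in Lfun mu 2%:E) : L2fun (toL2 fL) = f %[ae mu].
Proof. exact: svalP (toL2_key fL). Qed.

Let lcomb a u v : a *: L2fun u + L2fun v \in Lfun mu 2%:E.
Proof. exact: (Lfun_submod_closed mu (lee1n 2)).2 (L2funP u) (L2funP v). Qed.

Definition L2lin a u v : L2 := toL2 (lcomb a u v).

Let L2linE a u v : L2fun (L2lin a u v) = (fun x => a * u x + v x) %[ae mu].
Proof. exact: toL2K. Qed.

Definition L2zero : L2 := toL2 (Lfun_submod_closed mu (lee1n 2)).1.

Let L2zeroE : L2fun L2zero = cst 0 %[ae mu].
Proof. exact: toL2K. Qed.

Let L2add u v := L2lin 1 u v.
Let L2opp u := L2lin (-1) u L2zero.
Let L2scale a u := L2lin a u L2zero.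

Let L2addE u v : L2fun (L2add u v) = (fun x => u x + v x) %[ae mu].
Proof. by apply: filterS (L2linE 1 u v) => x /[apply]; rewrite mul1r. Qed.

Let L2scaleE a u : L2fun (L2scale a u) = (fun x => a * u x) %[ae mu].
Proof.
apply: filterS2 (L2linE a u L2zero) L2zeroE => x.
by move=> + + _ => /(_ I) + /(_ I); rewrite /L2fun => -> ->; rewrite addr0.
Qed.

Let L2oppE u : L2fun (L2opp u) = (fun x => - u x) %[ae mu].
Proof. by apply: filterS (L2scaleE (-1) u) => x /[apply]; rewrite mulN1r. Qed.

Let L2addA : associative L2add.
Proof.
move=> u v w; apply: L2fun_inj.
apply: filterS4 (L2addE u (L2add v w)) (L2addE v w) (L2addE (L2add u v) w) (L2addE u v) => x.
by move=> + + + + _ => /(_ I) + /(_ I) + /(_ I) + /(_ I); rewrite /L2fun => -> -> -> ->; rewrite addrA.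
Qed.

Let L2addC : commutative L2add.
Proof.
move=> u v; apply: L2fun_inj; apply: filterS2 (L2addE u v) (L2addE v u) => x.
by move=> + + _ => /(_ I) + /(_ I); rewrite /L2fun => -> ->; rewrite addrC.
Qed.

Let L2add0 : left_id L2zero L2add.
Proof.
move=> u; apply: L2fun_inj; apply: filterS2 (L2addE L2zero u) L2zeroE => x.
by move=> + + _ => /(_ I) + /(_ I); rewrite /L2fun => -> ->; rewrite add0r.
Qed.

Let L2addN : left_inverse L2zero L2opp L2add.
Proof.
move=> u; apply: L2fun_inj.
apply: filterS3 (L2addE (L2opp u) u) (L2oppE u) L2zeroE => x.
by move=> + + + _ => /(_ I) + /(_ I) + /(_ I); rewrite /L2fun => -> -> ->; rewrite addNr.
Qed.

HB.instance Definition _ := GRing.isZmodule.Build L2 L2addA L2addC L2add0 L2addN.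

Let L2scaleA a b u : L2scale a (L2scale b u) = L2scale (a * b) u.
Proof.
apply: L2fun_inj.
apply: filterS3 (L2scaleE a (L2scale b u)) (L2scaleE b u) (L2scaleE (a * b) u) => x.
by move=> + + + _ => /(_ I) + /(_ I) + /(_ I); rewrite /L2fun => -> -> ->; rewrite mulrA.
Qed.

Let L2scale1 : left_id 1 L2scale.
Proof.
move=> u; apply: L2fun_inj; apply: filterS (L2scaleE 1 u) => x.
by move=> + _ => /(_ I); rewrite /L2fun => ->; rewrite mul1r.
Qed.

Let L2scaleDr : right_distributive L2scale +%R.
Proof.
move=> a u v; apply: L2fun_inj.
apply: filterS4 (filterI (L2scaleE a (L2add u v)) (L2addE u v))
  (L2addE (L2scale a u) (L2scale a v)) (L2scaleE a u) (L2scaleE a v) => x [].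
move=> + + + + + _ => /(_ I) + /(_ I) + /(_ I) + /(_ I) + /(_ I).
by rewrite /L2fun => -> -> -> -> ->; rewrite mulrDr.
Qed.

Let L2scaleDl u : {morph L2scale^~ u : a b / a + b}.
Proof.
move=> a b; apply: L2fun_inj.
apply: filterS4 (L2scaleE (a + b) u) (L2addE (L2scale a u) (L2scale b u))
  (L2scaleE a u) (L2scaleE b u) => x.
move=> + + + + _ => /(_ I) + /(_ I) + /(_ I) + /(_ I); rewrite /L2fun => -> -> -> ->.
by rewrite mulrDl.
Qed.

HB.instance Definition _ := GRing.Zmodule_isLmodule.Build R L2
  L2scaleA L2scale1 L2scaleDr L2scaleDl.

Lemma L2funD u v : L2fun (u + v) = (fun x => u x + v x) %[ae mu].
Proof. exact: L2addE. Qed.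

Lemma L2funZ a u : L2fun (a *: u) = (fun x => a * u x) %[ae mu].
Proof. exact: L2scaleE. Qed.

Lemma L2fun0 : L2fun 0 = cst 0 %[ae mu].
Proof. exact: L2zeroE. Qed.

Lemma L2_integrable u v : mu.-integrable setT (EFin \o (fun x => u x * v x)).
Proof. exact/Lfun1_integrable/Lfun2_mul_Lfun1/L2funP/L2funP. Qed.

Lemma L2_measurable u : measurable_fun setT (u : T -> R).
Proof. by have /andP[/[!inE]] := L2funP u. Qed.

Definition L2inner u v : R := \int[mu]_x (u x * v x).

Let ae_Rint f g : measurable_fun setT f -> measurable_fun setT g ->
  f = g %[ae mu] -> \int[mu]_x f x = \int[mu]_x g x.
Proof.
move=> mf mg fg; congr fine; apply: ae_eq_integral => //.
- exact/measurable_EFinP.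
- exact/measurable_EFinP.
by apply: filterS fg => x /[apply] /= ->.
Qed.

Let L2innerC u v : L2inner u v = L2inner v u.
Proof. by apply: eq_Rintegral => x _; rewrite mulrC. Qed.

Let L2innerDl u v w : L2inner (u + v) w = L2inner u w + L2inner v w.
Proof.
rewrite /L2inner -RintegralD//; try exact: L2_integrable.
apply: ae_Rint.
- by apply: measurable_funM; exact: L2_measurable.
- by apply: measurable_funD; apply: measurable_funM; exact: L2_measurable.
apply: filterS (L2funD u v) => x /[apply]; rewrite /L2fun => ->.
by rewrite mulrDl.
Qed.

Let L2innerZl a u v : L2inner (a *: u) v = a * L2inner u v.
Proof.
rewrite /L2inner -RintegralZl//; try exact: L2_integrable.
apply: ae_Rint.
- by apply: measurable_funM; exact: L2_measurable.
- by apply: measurable_funM => //; apply: measurable_funM; exact: L2_measurable.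
apply: filterS (L2funZ a u) => x /[apply]; rewrite /L2fun => ->.
by rewrite mulrA.
Qed.

Let L2inner_ge0 u : 0 <= L2inner u u.
Proof. by apply: Rintegral_ge0 => x _; rewrite -expr2 sqr_ge0. Qed.

Let L2inner_eq0 u : L2inner u u = 0 -> u = 0.
Proof.
move=> uu; apply: L2fun_inj.
have : (\int[mu]_x `|(u x * u x)%:E|)%E = 0%E.
  under eq_integral do rewrite abse_EFin ger0_norm -?expr2 ?sqr_ge0// expr2.
  rewrite -(fineK (integrable_fin_num _ (L2_integrable u u)))//.
  by rewrite -[fine _]/(L2inner u u) uu.
move/ae_eq_integral_abs => /(_ measurableT).
have mu2 : measurable_fun setT (EFin \o (fun x => u x * u x)).
  by apply/measurable_EFinP; apply: measurable_funM; exact: L2_measurable.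
move=> /(_ mu2); apply: filterS2 L2fun0 => x + + _ => /(_ I) -> /(_ I)[].
by move=> /eqP; rewrite -expr2 sqrf_eq0 => /eqP.
Qed.

HB.instance Definition _ := Lmodule_isInnerProduct.Build R L2
  L2innerC L2innerDl L2innerZl L2inner_ge0 L2inner_eq0.

Lemma L2_innerE u v : inner u v = \int[mu]_x (u x * v x).
Proof. by []. Qed.

End L2.


(* An operator T : dom(T) in X -> Y is represented by its graph, a subset of *)
(* X * Y. The closure of an operator is the topological closure of its graph *)
(* in the product space.                                                    *)
Section operators.
Context (R : realType) (X Y : innerProductType R).
Implicit Types T : set (X * Y).

Definition op_dom T : set X := [set x | exists y, T (x, y)].

Definition op_ran T : set Y := [set y | exists x, T (x, y)].

Definition op_ker T : set X := [set x | T (x, 0)].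

Definition op_opp T : set (X * Y) := [set p | T (p.1, - p.2)].

Definition op_adj T : set (Y * X) :=
  [set p | forall x y, T (x, y) -> inner y p.1 = inner x p.2].

Definition orth (A : set X) : set X :=
  [set x | forall a, A a -> inner x a = 0].

Definition op_red T : set (X * Y) := [set p | T p /\ orth (op_ker T) p.1].

Definition graph_norm (p : X * Y) : R :=
  Num.sqrt (`|p.1| ^+ 2 + `|p.2| ^+ 2).

(* Compactness of the embedding into X of dom(T) with the graph norm: sets   *)
(* bounded in graph norm are relatively compact in X.                       *)
Definition compact_embedding T := forall B : set X, B `<=` op_dom T ->
  (exists M, forall x y, B x -> T (x, y) -> graph_norm (x, y) <= M) ->
  precompact B.

End operators.

Definition dotR (R : realType) n (x y : 'rV[R]_n) : R :=
  \sum_i x 0 i * y 0 i.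

(* The library norm on ['rV_n] is the maximum norm.                         *)
Definition euclidean_norm (R : realType) n (x : 'rV[R]_n) : R :=
  Num.sqrt (dotR x x).

Section test_functions.
Context (R : realType) (n : nat).
Implicit Types f : 'rV[R]_n -> R.

Definition partial (i : 'I_n) f : 'rV[R]_n -> R := 'D_(delta_mx 0 i) f.

Definition smooth f := forall s : seq 'I_n,
  continuous (foldr partial f s) /\
  forall i x, derivable (foldr partial f s) x (delta_mx 0 i).

(* Functions on Omega with compact support are identified with their         *)
(* extension by zero.                                                       *)
Definition test_function (Omega : set 'rV[R]_n) f :=
  let supp := closure [set x | f x != 0] in
  [/\ smooth f, compact supp & supp `<=` Omega].

End test_functions.

Definition lebesgue_on (R : realType) n (Omega : set 'rV[R]_n)
    (oOmega : open Omega) : {measure set 'rV[R]_n -> \bar R} :=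
  mrestr (lebesgue_rV R n) (open_measurable_rV oOmega).

Notation L2 oOmega := (LspaceType2 (lebesgue_on oOmega)).

Section grad_div.
Context (R : realType) (n : nat) (Omega : set 'rV[R]_n).
Variable oOmega : open Omega.

Local Notation mu := (lebesgue_on oOmega).
Local Notation L2 := (L2 oOmega).
Local Notation L2n := {ffun 'I_n -> L2}.

Definition grad_c : set (L2 * L2n) := [set p : L2 * L2n | exists phi,
  [/\ test_function Omega phi, L2fun p.1 = phi %[ae mu] &
      forall j, L2fun (p.2 j) = partial j phi %[ae mu]]].

Definition div_c : set (L2n * L2) :=
  [set p : L2n * L2 | exists Psi : 'I_n -> 'rV[R]_n -> R,
  [/\ forall j, test_function Omega (Psi j),
      forall j, L2fun (p.1 j) = Psi j %[ae mu] &
      p.2 = (fun x => \sum_j partial j (Psi j) x) %[ae mu]]].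

Definition grad_0 : set (L2 * L2n) := closure grad_c.

Definition div_0 : set (L2n * L2) := closure div_c.

Definition grad : set (L2 * L2n) := op_opp (op_adj div_0).

Definition div : set (L2n * L2) := op_opp (op_adj grad_0).

Definition grad_sharp : set (L2 * L2n) :=
  [set p | grad p /\ closure (op_ran grad_0) p.2].

Definition div_sharp : set (L2n * L2) :=
  [set p | div p /\ closure (op_ran div_0) p.2].

End grad_div.

Arguments grad_c {R n Omega} oOmega.
Arguments div_c {R n Omega} oOmega.
Arguments grad_0 {R n Omega} oOmega.
Arguments div_0 {R n Omega} oOmega.
Arguments grad {R n Omega} oOmega.
Arguments div {R n Omega} oOmega.
Arguments grad_sharp {R n Omega} oOmega.
Arguments div_sharp {R n Omega} oOmega.

(* Main.v *)
Require Import Defs.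
From mathcomp Require Import all_boot all_order all_algebra.
From mathcomp Require Import all_classical all_reals all_analysis.
From mathcomp Require Import measurable_realfun ring lra.

Set Implicit Arguments.
Unset Strict Implicit.
Unset Printing Implicit Defensive.
Import Order.TTheory GRing.Theory Num.Theory.
Import numFieldNormedType.Exports.
Local Open Scope classical_set_scope.
Local Open Scope ring_scope.

(* With G the closure of grad_c and D that of div_c, integration by parts
   gives G ⊆ grad and D ⊆ div, and the Poincaré inequality for a slab makes
   ran G closed.  Hence grad^# = G + ker grad, and the range of grad^# is
   that of G.  The equality grad^# = -(div^#)^* then follows from
   ker div = (ran G)^⊥ and the projection theorem in the Hilbert space L2^n.
   For bounded Omega, Rellich compactness holds on dom G.  It is transferred
   to (grad^#)_red because u ⊥ ker grad and u - v in ker grad give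
   |u - u'| <= |v - v'|, and to (div^#)_red because Psi = G v there and
   |Psi - Psi'|^2 = - <v - v', div (Psi - Psi')>.
   Rellich's theorem is used in the form: for every e > 0 there are finitely
   many h_j in L2 and K with |f|^2 <= e |grad f|^2 + K sum_j <f, h_j>^2.  This
   is proved by induction on the dimension: cut the first coordinate into
   short cells and compare the functions t |-> <f(t, .), h_j> with their
   averages over the cells. *)

(** * Inner product spaces *)

(** Nothing is assumed about the boundary of Omega, so compactness need not hold on the whole of
    H^1(Omega). Test functions, however, extend by zero to R^n: every estimate is proved for C^1
    functions that vanish off a cube, and then passed to the closures. This is one reason to state
    Rellich's theorem as an inequality: for fixed h_j and K it is a closed condition on (v, g). The
    other is that it suits induction: it holds on every slice with the same constants and can be
    integrated in the remaining variable. It yields compactness because, for bounded gradients,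
    finitely many numbers <v, h_j> determine v up to a given error. Completeness of L2 enters in the
    closedness of ran G, in the projection theorem and in the convergence of ultrafilters. *)

Lemma fmap_ultra (T U : Type) (f : T -> U) (F : set_system T) :
  UltraFilter F -> UltraFilter (f @ F).
Proof.
move=> FU; have FF : ProperFilter F by exact: ultra_proper.
split; first exact: fmap_proper_filter.
move=> G GP FG; apply/seteqP; split=> // A GA.
have [//|FA] := in_ultra_setVsetC (f @^-1` A) FU.
have /(filterI GA) : G (~` A) by exact: FG.
by rewrite setICr => /filter_ex[].
Qed.

Section inner_theory.
Context (R : realType) (V : innerProductType R).
Implicit Types x y z : V.

Lemma innerDr x y z : inner x (y + z) = inner x y + inner x z.
Proof. by rewrite innerC innerDl !(innerC _ x). Qed.

Lemma innerZr a x y : inner x (a *: y) = a * inner x y.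
Proof. by rewrite innerC innerZl innerC. Qed.

Lemma innerNl x y : inner (- x) y = - inner x y.
Proof. by rewrite -scaleN1r innerZl mulN1r. Qed.

Lemma innerNr x y : inner x (- y) = - inner x y.
Proof. by rewrite innerC innerNl innerC. Qed.

Lemma inner0l x : inner 0 x = 0.
Proof. by rewrite -(scale0r 0) innerZl mul0r. Qed.

Lemma inner0r x : inner x 0 = 0.
Proof. by rewrite innerC inner0l. Qed.

Lemma innerBl x y z : inner (x - y) z = inner x z - inner y z.
Proof. by rewrite innerDl innerNl. Qed.

Lemma innerBr x y z : inner x (y - z) = inner x y - inner x z.
Proof. by rewrite innerDr innerNr. Qed.

Lemma sqr_normD x y : `|x + y| ^+ 2 = `|x| ^+ 2 + inner x y *+ 2 + `|y| ^+ 2.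
Proof. by rewrite -!inner_norm innerDl !innerDr (innerC y x); ring. Qed.

Lemma sqr_normB x y : `|x - y| ^+ 2 = `|x| ^+ 2 - inner x y *+ 2 + `|y| ^+ 2.
Proof. by rewrite sqr_normD innerNr normrN mulNrn. Qed.

Lemma inner_le_norm x y : `|inner x y| <= `|x| * `|y|.
Proof.
rewrite -ler_sqr ?nnegrE ?mulr_ge0// exprMn real_normK ?num_real//.
have [->|y0] := eqVneq y 0; first by rewrite inner0r normr0 expr0n/= mulr0.
have yp : 0 < `|y| ^+ 2 by rewrite exprn_gt0// normr_gt0.
have := sqr_ge0 `|x - (inner x y / `|y| ^+ 2) *: y|.
rewrite sqr_normB innerZr normrZ exprMn real_normK ?num_real//.
rewrite -(pmulr_rge0 _ yp) -[inner x y ^+ 2 <= _]subr_ge0.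
by rewrite (_ : `|y| ^+ 2 * _ = `|x| ^+ 2 * `|y| ^+ 2 - inner x y ^+ 2)//; field;
  rewrite normr_eq0.
Qed.

Lemma continuous_innerl y : continuous (fun x => inner x y).
Proof.
move=> x; apply/cvgrPdist_le => e e0.
have k0 : 0 < `|y| + 1 by rewrite ltr_wpDl.
have /cvgrPdist_le/(_ (e / (`|y| + 1))) : id @ x --> x by exact: cvg_id.
move=> /(_ (divr_gt0 e0 k0)); apply: filterS => z xz.
rewrite -innerBl (le_trans (inner_le_norm _ _))//.
rewrite (@le_trans _ _ (e / (`|y| + 1) * (`|y| + 1)))//.
  by rewrite ler_pM// lerDl.
by rewrite divfK// gt_eqF.
Qed.

Lemma continuous_innerr x : continuous (inner x).
Proof.
have -> : inner x = fun y => inner y x by apply/funext => y; rewrite innerC.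
exact: continuous_innerl.
Qed.

(** Completeness is a separate predicate because [innerProductType] does not contain it. It is
    phrased with Cauchy filters since it is applied to ultrafilters and to filters of sublevel
    sets. *)
Definition hilbert_complete := forall F : set_system V, ProperFilter F ->
  (forall e, 0 < e ->
    exists2 A, F A & forall x y, A x -> A y -> `|x - y| <= e) ->
  exists l : V, F --> l.

Lemma filter_dist_cvg (F : set_system V) (l : V) {FF : Filter F} :
  (forall e, 0 < e -> exists2 A, F A & forall x, A x -> `|l - x| <= e) -> F --> l.
Proof.
move=> H; apply/(@cvgrPdist_le _ _ _ F FF id) => e e0.
by have [A FA Ae] := H _ e0; apply: filterS FA.
Qed.

Definition subspace_set (A : set V) :=
  A 0 /\ forall a x y, A x -> A y -> A (a *: x + y).

(** The parallelogram law for [g - x] and [g - y]. If both points almost minimise the distance to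
    [g], their midpoint cannot do much better, so they are close to each other. *)
Lemma sqr_paralB g x y : `|x - y| ^+ 2 = `|g - x| ^+ 2 *+ 2 + `|g - y| ^+ 2 *+ 2
   - `|g - 2^-1 *: (x + y)| ^+ 2 *+ 4.
Proof.
rewrite !sqr_normB innerZr normrZ exprMn sqr_normD innerDr.
by rewrite ger0_norm ?invr_ge0//; field.
Qed.

Lemma projection_exists (A : set V) g : hilbert_complete -> closed A ->
  subspace_set A -> exists2 a, A a & orth A (g - a).
Proof.
move=> hV cA [A0 SA].
pose S := [set r | exists2 a, A a & r = `|g - a| ^+ 2].
have hS : has_inf S.
  split; first by exists (`|g - 0| ^+ 2), 0.
  by exists 0 => r [a _ ->]; exact: sqr_ge0.
pose d := inf S.
have dle a : A a -> d <= `|g - a| ^+ 2 by move=> Aa; apply: ge_inf; [case: hS|exists a].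
pose B e := [set a | A a /\ `|g - a| ^+ 2 <= d + e].
pose F := filter_from [set e : R | 0 < e] B.
have FF : ProperFilter F.
  apply: filter_from_proper; last first.
    move=> e e0; have [_ [a Aa ->] ae] := inf_adherent e0 hS.
    by exists a; split => //; exact: ltW.
  apply: filter_from_filter; first by exists 1 => /=.
  move=> i j i0 j0; exists (Num.min i j); first by rewrite /= lt_min i0 j0.
  move=> a [Aa ad]; split; split=> //; apply: le_trans ad _; rewrite lerD2l.
    by rewrite ge_min lexx.
  by rewrite ge_min lexx orbT.
have [|a Fa] := hV F FF.
  (* Both squared distances are at most d + e^2/4 and that of the midpoint is at least d, so
     [sqr_paralB] leaves 4 (d + e^2/4) - 4 d = e^2. *)
  move=> e e0; exists (B (e ^+ 2 / 4)); first by exists (e ^+ 2 / 4) => //=;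
    rewrite divr_gt0// exprn_gt0.
  move=> x y [Ax xd] [Ay yd]; rewrite -ler_sqr ?nnegrE ?(ltW e0)//.
  rewrite (sqr_paralB g).
  have /dle : A (2^-1 *: (x + y)).
    rewrite -[2^-1 *: _]addr0; apply: (SA) => //.
    by rewrite -[x]scale1r; exact: SA.
  lra.
have Aa : A a.
  apply: (@closed_cvg _ _ F FF id A) => //.
  by exists 1 => //= x [].
have ad : `|g - a| ^+ 2 <= d.
  apply/ler_addgt0Pr => e e0.
  have cn : (fun x => `|g - x| ^+ 2) @ F --> `|g - a| ^+ 2.
    apply: cvgM; apply: cvg_norm; apply: cvgB => //; exact: cvg_cst.
  by apply: (cvgr_to_le cn); exists e => //= x [].
exists a => // b Ab.
(* Minimality of [a] against the competitor [t *: b + a]; the optimal [t] below forces the inner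
   product to vanish. *)
have key t : 0 <= t ^+ 2 * `|b| ^+ 2 - t * inner (g - a) b *+ 2.
  have /dle : A (t *: b + a) by exact: SA.
  move=> /(le_trans ad).
  rewrite (_ : g - (t *: b + a) = (g - a) - t *: b); last first.
    by rewrite opprD addrCA addrC addrAC.
  rewrite (sqr_normB (g - a)) innerZr normrZ exprMn.
  by rewrite real_normK ?num_real//; lra.
have [b0|b0] := eqVneq (`|b| ^+ 2) 0.
  by move: b0 => /eqP; rewrite sqrf_eq0 normr_eq0 => /eqP ->; rewrite inner0r.
have := key (inner (g - a) b / `|b| ^+ 2).
set i := inner _ _; set q := `|b| ^+ 2 in b0 *.
rewrite (_ : _ - _ = - (i ^+ 2 / q)); last by field.
rewrite oppr_ge0 pmulr_lle0 ?invr_gt0 ?lt_neqAle ?(eq_sym 0) ?b0 ?sqr_ge0// => i0.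
by apply/eqP; rewrite -sqrf_eq0 eq_le i0 sqr_ge0.
Qed.

Lemma orth_orth_sub (A : set V) : hilbert_complete -> closed A ->
  subspace_set A -> orth (orth A) `<=` A.
Proof.
move=> hV cA sA g gA; have [a Aa ga] := projection_exists g hV cA sA.
suff : `|g - a| ^+ 2 = 0.
  by move=> /eqP; rewrite sqrf_eq0 normr_eq0 subr_eq0 => /eqP ->.
by rewrite -inner_norm innerBl (innerC a) (ga _ Aa) (gA _ ga) subrr.
Qed.

(* An ultrafilter on B has a limit along each of the finitely many bounded f_i,
   hence it is Cauchy. *)
Lemma precompact_of_functionals (B : set V) : hilbert_complete ->
  (forall e, 0 < e -> exists (I : finType) (f : I -> V -> R) (M eta : R),
    [/\ 0 < eta, forall i x, B x -> `|f i x| <= M &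
      forall x y, B x -> B y -> (forall i, `|f i x - f i y| <= eta) ->
        `|x - y| <= e]) ->
  precompact B.
Proof.
move=> hV H; rewrite precompactE compact_ultra => F FU FB.
have FF : ProperFilter F by exact: ultra_proper.
suff [l Fl] : exists l : V, F --> l.
  exists l; split => //; have := @closed_cvg _ _ F FF id (closure B) (@closed_closure _ B).
  exact.
apply: hV => e e0.
have e3 : 0 < e / 3 by rewrite divr_gt0.
have [I [f [M [eta [eta0 fM fe]]]]] := H _ e3.
(* [F] contains the closure of [B], but the bounds hold on [B] only: the functionals are evaluated
   at a point [b x] of [B] within e/3 of [x]. *)
have nearB x : closure B x -> exists b, B b /\ `|x - b| <= e / 3.
  move=> /(_ (ball x (e / 3))); case; first exact: nbhsx_ballx.
  by move=> b [Bb xb]; exists b; split => //; apply: ltW; move: xb; rewrite -ball_normE.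
pose b x := if pselect (closure B x) is left xB then sval (cid (nearB x xB)) else 0.
have bP x : closure B x -> B (b x) /\ `|x - b x| <= e / 3.
  by rewrite /b; case: pselect => // xB _; case: cid.
(* The image of an ultrafilter under a bounded functional is an ultrafilter on a compact segment,
   hence it converges. *)
have fcvg i : exists l : R, (f i \o b) @ F --> l.
  have UG : UltraFilter ((f i \o b) @ F).
    exact: fmap_ultra.
  have := @segment_compact _ (- M) M; rewrite compact_ultra => /(_ _ UG).
  case; last by move=> l [_ fl]; exists l.
  suff : F ((f i \o b) @^-1` `[- M, M]) by [].
  apply: filterS (FB) => x /bP[Bb _] /=.
  by rewrite in_itv/= -ler_norml; exact: fM.
have {fcvg} [l fl] : exists l : I -> R, forall i, (f i \o b) @ F --> l i.
  by have [l lP] := choice fcvg; exists l.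
pose A := [set x | closure B x /\ forall i, `|l i - f i (b x)| <= eta / 2].
exists A.
  apply: filterI => //; apply: filter_forall => i.
  have /cvgrPdist_le/(_ (eta / 2)) := fl i; apply; exact: divr_gt0.
move=> x y [xB fx] [yB fy]; have [Bx bx] := bP _ xB; have [By by_] := bP _ yB.
have bb : `|b x - b y| <= e / 3.
  apply: fe => // i; rewrite (_ : eta = eta / 2 + eta / 2); last lra.
  by rewrite (le_trans (ler_distD (l i) _ _))// lerD// distrC.
rewrite (_ : e = e / 3 + (e / 3 + e / 3)); last lra.
rewrite (le_trans (ler_distD (b x) _ _))// lerD//.
by rewrite (le_trans (ler_distD (b y) _ _))// lerD// distrC.
Qed.

End inner_theory.
Arguments hilbert_complete {R} V.

(** * Abstract operators *)

Section ffun_complete.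
Context (R : realType) (V : innerProductType R) (n : nat).
Implicit Types f g : {ffun 'I_n -> V}.

Lemma inner_ffunE f g : inner f g = \sum_i inner (f i) (g i).
Proof. by []. Qed.

Lemma sqr_norm_ffun f : `|f| ^+ 2 = \sum_i `|f i| ^+ 2.
Proof. by rewrite -inner_norm inner_ffunE; apply: eq_bigr => i _; rewrite inner_norm. Qed.

Lemma norm_coord_le f i : `|f i| <= `|f|.
Proof.
rewrite -ler_sqr ?nnegrE// sqr_norm_ffun (bigD1 i)//= lerDl.
by apply: sumr_ge0 => j _; exact: sqr_ge0.
Qed.

Lemma ffun_complete : hilbert_complete V -> hilbert_complete {ffun 'I_n -> V}.
Proof.
move=> hV F FF FC.
have lE : forall i, exists l : V, (fun f : {ffun 'I_n -> V} => f i) @ F --> l.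
  move=> i; apply: hV => e /FC[A FA Ae]; exists [set x | exists2 f, A f & f i = x].
    suff : F [set f | exists2 g, A g & g i = f i] by [].
    by apply: filterS FA => f Af; exists f.
  move=> _ _ [f Af <-] [g Ag <-]; rewrite (le_trans _ (Ae _ _ Af Ag))//.
  by rewrite (le_trans _ (norm_coord_le _ i))// !ffunE.
have [l Fl] := choice lE.
exists (finfun l); apply: filter_dist_cvg => e e0.
(* Dividing by n + 1 covers n = 0; the n squares of e / (n + 1) sum to at most e^2. *)
have eta0 : 0 < e / n.+1%:R by rewrite divr_gt0.
exists [set f : {ffun 'I_n -> V} | forall i, `|l i - f i| <= e / n.+1%:R].
  by apply: filter_forall => i; have /cvgrPdist_le := Fl i; exact.
move=> f lf; rewrite -ler_sqr ?nnegrE ?(ltW e0)// sqr_norm_ffun.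
rewrite (@le_trans _ _ (\sum_(i < n) (e / n.+1%:R) ^+ 2))//.
  by apply: ler_sum => i _; rewrite !ffunE ler_sqr ?nnegrE ?(ltW eta0)//.
rewrite sumr_const card_ord expr_div_n -(mulr_natr (_ / _) n) -mulrA ler_piMr ?sqr_ge0//.
rewrite ler_pdivrMl ?exprn_gt0// mulr1 -natrX ler_nat.
by rewrite (leq_trans (leqnSn n))// expnS expn1 leq_pmulr.
Qed.

End ffun_complete.

(** * Closed range, adjoint identity and compactness for an abstract pair of operators *)

Section abstract_operators.
Context (R : realType) (X Y : innerProductType R).
Hypotheses (hX : hilbert_complete X) (hY : hilbert_complete Y).
Variables (G : set (X * Y)) (D : set (Y * X)).
Hypothesis cG : closed G.
Hypothesis G00 : G (0, 0).
Hypothesis GL : forall a v g v' g', G (v, g) -> G (v', g') ->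
  G (a *: v + v', a *: g + g').
Hypothesis D00 : D (0, 0).
Hypothesis dual : forall v g Psi d, G (v, g) -> D (Psi, d) ->
  inner d v = - inner Psi g.
Variable C : R.
Hypothesis C0 : 0 <= C.
Hypothesis poincare : forall v g, G (v, g) -> `|v| <= C * `|g|.

Local Notation grd := (op_opp (op_adj D)).
Local Notation dv := (op_opp (op_adj G)).
Local Notation gs := [set p | grd p /\ closure (op_ran G) p.2].
Local Notation ds := [set p | dv p /\ closure (op_ran D) p.2].

Let grdE u g : grd (u, g) <-> forall Psi d, D (Psi, d) -> inner d u = - inner Psi g.
Proof. by split=> H Psi d /H /=; rewrite innerNr. Qed.

Let dvE Psi d : dv (Psi, d) <-> forall v g, G (v, g) -> inner g Psi = - inner v d.
Proof. by split=> H v g /H /=; rewrite innerNr. Qed.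

Let GB v g v' g' : G (v, g) -> G (v', g') -> G (v - v', g - g').
Proof.
by move=> Gv Gv'; have := GL (-1) Gv' Gv; rewrite !scaleN1r !(addrC (- _)).
Qed.

Let sub_grd : G `<=` grd.
Proof. by move=> [v g] Gv; apply/grdE => Psi d; exact: dual. Qed.

Let sub_dv : D `<=` dv.
Proof.
move=> [Psi d] Dd; apply/dvE => v g Gv.
by rewrite (innerC v) (dual Gv Dd) opprK innerC.
Qed.

(** By Poincaré, preimages depend on their images in a Lipschitz way. Along a filter in the range
    that converges to [g] they are therefore Cauchy, and their limit is a preimage of [g] since [G]
    is closed. *)
Lemma op_ran_closed : closed (op_ran G).
Proof.
move=> g; rewrite closureEcvg => -[F FF [Fg FG]].
have FGr : F (op_ran G) by exact: FG.
have vE : forall y, exists v, op_ran G y -> G (v, y).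
  move=> y; have [[v Gv]|nG] := pselect (op_ran G y); first by exists v.
  by exists 0.
have [v vP] := choice vE.
have [v0 vv0] : exists v0 : X, v @ F --> v0.
  (* [C] may be 0, hence [C + 1]; the factor 1/2 is there because both images are compared with
     [g]. *)
  apply: hX => e e0; have k0 : 0 < C + 1 by rewrite ltr_wpDl.
  have e1 : 0 < e / (C + 1) / 2 by rewrite !divr_gt0.
  exists (v @` (op_ran G `&` [set y | `|g - y| <= e / (C + 1) / 2])).
    have : F (op_ran G `&` [set y | `|g - y| <= e / (C + 1) / 2]).
      by apply: filterI => //; have /(@cvgrPdist_le _ _ _ F _ id) := Fg; exact.
    move=> FB; suff : F (v @^-1` (v @` (op_ran G `&` [set y | `|g - y| <= e / (C + 1) /
      2]))) by [].
    by apply: filterS FB => y ?; exists y.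
  move=> _ _ [y [/vP Gy gy] <-] [z [/vP Gz gz] <-].
  rewrite (le_trans (poincare (GB Gy Gz)))//.
  rewrite (@le_trans _ _ ((C + 1) * (e / (C + 1))))//; last first.
    by rewrite mulrCA divff ?mulr1// gt_eqF.
  apply: ler_pM => //; first by rewrite lerDl.
  rewrite [leRHS]splitr (le_trans (ler_distD g _ _))// lerD//.
  by rewrite distrC.
exists v0; apply: (@closed_cvg _ _ F FF (fun y => (v y, y)) G cG) => //.
  by apply: filterS FGr => y /vP.
exact: cvg_pair.
Qed.

Let in_ranG g : closure (op_ran G) g -> exists v, G (v, g).
Proof. by move: op_ran_closed => /closure_id <-. Qed.

Let sub_gs : G `<=` gs.
Proof.
move=> [v g] Gv; split; first exact: sub_grd.
by apply: subset_closure; exists v.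
Qed.

Let ker_grd_orth w d : grd (w, 0) -> closure (op_ran D) d -> inner d w = 0.
Proof.
move=> /grdE gw; rewrite closureEcvg => -[F FF [Fd FD]].
have cl : closed [set r : R | r = 0] by exact: closed_eq.
have cvd : (fun d => inner d w) @ F --> inner d w.
  exact: cvg_comp Fd (@continuous_innerl _ _ w d).
apply: (@closed_cvg _ _ F FF (fun d => inner d w) _ cl _ _ cvd).
apply: FD => e [Psi Dd] /=.
by rewrite (gw _ _ Dd) inner0r oppr0.
Qed.

(** One inclusion of ker dv = (ran G)^⊥. The value 0 lies in the range of [D], so these elements
    even belong to the restriction [ds]. *)
Let ker_dv Psi : orth (op_ran G) Psi -> ds (Psi, 0).
Proof.
move=> oPsi; split; last by apply: subset_closure; exists 0.
by apply/dvE => v g Gv; rewrite inner0r oppr0 innerC; apply: oPsi; exists v.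
Qed.

Let ranG_subspace : subspace_set (op_ran G).
Proof.
split; first by exists 0.
by move=> a x y [v Gv] [w Gw]; exists (a *: v + w); exact: GL.
Qed.

Lemma grad_sharp_ran_closed : closed (op_ran gs).
Proof.
suff -> : op_ran gs = op_ran G by exact: op_ran_closed.
apply/seteqP; split=> [g [u [_ /in_ranG]]//|g [v Gv]].
by exists v; exact: sub_gs.
Qed.

Let gs_decomp u g : gs (u, g) -> exists v, G (v, g) /\ grd (u - v, 0).
Proof.
move=> [/grdE gu /in_ranG[v Gv]]; exists v; split => //.
by apply/grdE => Psi d Dd; rewrite innerBr (gu _ _ Dd) (dual Gv Dd) inner0r; lra.
Qed.

Lemma grad_sharp_adj : gs = op_opp (op_adj ds).
Proof.
apply/seteqP; split=> -[u g].
  (* The part [u - v] in the kernel of [grd] is orthogonal to [d]; the part [v] is handled by the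
     definition of [dv]. *)
  move=> /gs_decomp[v [Gv gw]] Psi d [/dvE dPsi /= Dd].
  rewrite -[u](subrK v) innerDr (ker_grd_orth gw Dd) add0r innerNr.
  by rewrite (innerC Psi) (dPsi _ _ Gv) opprK innerC.
move=> ug; have ugE Psi d : ds (Psi, d) -> inner d u = - inner Psi g.
  by move=> dP; rewrite -innerNr; exact: ug.
split.
  apply/grdE => Psi d Dd; apply: ugE; split; first exact: sub_dv.
  by apply: subset_closure; exists Psi.
(* On (ran G)^⊥ the operator [ds] is 0, so testing there shows that [g] lies in the double
   complement of ran G. *)
apply: subset_closure; apply: (orth_orth_sub hY op_ran_closed ranG_subspace).
move=> Psi /ker_dv/ugE; rewrite inner0l innerC => /eqP.
by rewrite eq_sym oppr_eq0 => /eqP.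
Qed.

Hypothesis rellich : forall e, 0 < e -> exists (I : finType) (h : I -> X) (K : R),
  forall v g, G (v, g) -> `|v| ^+ 2 <= e * `|g| ^+ 2 + K * \sum_i inner v (h i) ^+ 2.

(** Turns [rellich], applied to differences [v - v'], into the data that [precompact_of_functionals]
    asks for. *)
Let rellich_functionals M e : 0 <= M -> 0 < e ->
  exists (I : finType) (h : I -> X) (L eta : R),
  [/\ 0 < eta, forall i v g, G (v, g) -> `|g| <= M -> `|inner v (h i)| <= L &
    forall v g v' g', G (v, g) -> G (v', g') -> `|g| <= M -> `|g'| <= M ->
     (forall i, `|inner v (h i) - inner v' (h i)| <= eta) -> `|v - v'| <= e].
Proof.
(* As |g - g'| <= 2 M, this [e1] makes the gradient term at most e^2/2; the + 1 guards against M =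
   0. *)
move=> M0 e0; pose e1 := e ^+ 2 / 2 / ((M + M) ^+ 2 + 1).
have ee : 0 < e ^+ 2 / 2 by rewrite divr_gt0// exprn_gt0.
have e1p : 0 < e1 by rewrite divr_gt0// ltr_wpDl ?sqr_ge0.
have [I [h [K hK]]] := rellich e1p.
pose q := `|K| * #|I|%:R + 1.
have q0 : 0 < q by rewrite ltr_wpDl// mulr_ge0.
(* [eta <= 1] gives eta^2 <= eta, so the functionals contribute at most q eta <= e^2/2. *)
pose eta := Num.min 1 (e ^+ 2 / 2 / q).
have eta0 : 0 < eta by rewrite lt_min ltr01/= divr_gt0.
exists I, h, (C * M * \sum_i `|h i|), eta; split => //.
  move=> i v g Gv gM; rewrite (le_trans (inner_le_norm _ _))// ler_pM//.
    by rewrite (le_trans (poincare Gv))// ler_wpM2l.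
  by rewrite (bigD1 i)//= lerDl sumr_ge0.
move=> v g v' g' Gv Gv' gM gM' hv.
rewrite -ler_sqr ?nnegrE ?(ltW e0)// (le_trans (hK _ _ (GB Gv Gv')))//.
rewrite [leRHS]splitr lerD//.
  rewrite (@le_trans _ _ (e1 * (M + M) ^+ 2))//.
    rewrite ler_wpM2l ?(ltW e1p)// ler_sqr ?nnegrE ?addr_ge0//.
    by rewrite (le_trans (ler_normB _ _))// lerD.
  rewrite /e1 mulrAC ler_pdivrMr ?ltr_wpDl ?sqr_ge0// ler_wpM2l ?(ltW ee)//.
  by rewrite lerDl.
rewrite (@le_trans _ _ (`|K| * (#|I|%:R * eta)))//.
  apply: (@le_trans _ _ (`|K| * \sum_i inner (v - v') (h i) ^+ 2)).
    by rewrite ler_wpM2r ?ler_norm// sumr_ge0// => i _; exact: sqr_ge0.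
  rewrite ler_wpM2l// (@le_trans _ _ (\sum_(i : I) eta))//.
    apply: ler_sum => i _; rewrite innerBl.
    rewrite -[_ ^+ 2]real_normK ?num_real// expr2.
    rewrite -[leRHS]mul1r ler_pM//.
    by rewrite (le_trans (hv i))// /eta ge_min lexx.
  by rewrite sumr_const mulr_natl.
rewrite mulrA (@le_trans _ _ (q * eta))//.
  by rewrite ler_wpM2r ?(ltW eta0)// lerDl.
by rewrite mulrC -ler_pdivlMr// /eta ge_min lexx orbT.
Qed.

Let graph_norm_le (Z W : innerProductType R) (z : Z) (w : W) M :
  graph_norm (z, w) <= M -> `|z| <= M /\ `|w| <= M.
Proof.
move=> H; have M0 : 0 <= M by apply: le_trans H; exact: sqrtr_ge0.
by split; apply: le_trans H; rewrite -[leLHS]ger0_norm// -sqrtr_sqr ler_wsqrtr//=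
  ?lerDl ?lerDr sqr_ge0.
Qed.

Lemma grad_sharp_red_compact : compact_embedding (op_red gs).
Proof.
move=> B BD [M BM].
(* A negative bound forces [B] to be empty; afterwards 0 <= M. *)
have [M0|M0] := ltP M 0.
  suff -> : B = set0 by rewrite precompactE closure0; exact: compact0.
  rewrite -subset0 => u Bu; have [g rg] := BD u Bu.
  by have /graph_norm_le[uM _] := BM _ _ Bu rg; have := le_lt_trans uM M0;
    rewrite normr_lt0.
have vgE : forall u, exists p : X * Y, B u -> [/\ G p, grd (u - p.1, 0),
    orth (op_ker gs) u & `|p.2| <= M].
  move=> u; have [Bu|] := pselect (B u); last by exists (0, 0).
  have [g [gsu ou]] := BD u Bu; have [v [Gv gw]] := gs_decomp gsu.
  by exists (v, g) => _; split=> //; have [] := graph_norm_le (BM _ _ Bu (conj gsu ou)).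
have [vg vgP] := choice vgE.
apply: precompact_of_functionals => // e e0.
have [I [h [L [eta [eta0 hL he]]]]] := rellich_functionals M0 e0.
exists I, (fun i u => inner (vg u).1 (h i)), L, eta; split => //.
  move=> i u /vgP; case: (vg u) => v g [Gv _ _ gM]; exact: hL Gv gM.
move=> u u' /vgP + /vgP; case: (vg u) => v g; case: (vg u') => v' g' /=.
move=> [Gv gw ou gM] [Gv' gw' ou' gM'] hv.
rewrite (le_trans _ (he _ _ _ _ Gv Gv' gM gM' hv))//.
have ow w : grd (w, 0) -> inner (u - u') w = 0.
  move=> kw; suff ww : op_ker gs w by rewrite innerBl ou// ou'// subr0.
  by split => //=; apply: subset_closure; exists 0.
have [->|uu] := eqVneq (u - u') 0; first by rewrite normr0.
(* After multiplication by |u - u'|, the kernel parts drop out of <u - u', u - u'> and leave <u -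
   u', v - v'>. *)
rewrite -(@ler_pM2l _ `|u - u'|) ?normr_gt0// -expr2 -inner_norm.
rewrite [in X in inner _ X](_ : u - u' = (v - v') + ((u - v) - (u' - v'))); last first.
  by rewrite -{1}(subrK v u) -{1}(subrK v' u') opprD addrACA addrC.
have [e1 e2] := (ow _ gw, ow _ gw').
rewrite [in leLHS]innerDr [X in _ + X]innerBr e1 e2 subr0 addr0.
apply: le_trans (ler_norm _) _.
exact: inner_le_norm.
Qed.

Lemma div_sharp_red_compact : compact_embedding (op_red ds).
Proof.
move=> B BD [M BM].
have [M0|M0] := ltP M 0.
  suff -> : B = set0 by rewrite precompactE closure0; exact: compact0.
  rewrite -subset0 => u Bu; have [g rg] := BD u Bu.
  by have /graph_norm_le[uM _] := BM _ _ Bu rg; have := le_lt_trans uM M0;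
    rewrite normr_lt0.
have vdE : forall Psi, exists p : X * X, B Psi -> [/\ G (p.1, Psi), dv (Psi, p.2),
    `|Psi| <= M & `|p.2| <= M].
  move=> Psi; have [BPsi|] := pselect (B Psi); last by exists (0, 0).
  have [d [[dPsi cd] oPsi]] := BD _ BPsi.
  (* Psi is orthogonal to the kernel of [ds], which contains (ran G)^⊥ by [ker_dv]. *)
  have : op_ran G Psi.
    apply: (orth_orth_sub hY op_ran_closed ranG_subspace) => Phi oPhi.
    by apply: oPsi; exact: ker_dv.
  move=> [v Gv]; exists (v, d) => _.
  by have [] := graph_norm_le (BM _ _ BPsi (conj (conj dPsi cd) oPsi)).
have [vd vdP] := choice vdE.
apply: precompact_of_functionals => // e e0.
(* The potentials must be close to within e^2 divided by the bound 2 M of |d - d'|; the + 1 keeps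
   the divisor positive. *)
pose e1 := e ^+ 2 / (M + M + 1).
have M1 : 0 < M + M + 1 by rewrite ltr_wpDl// addr_ge0.
have e1p : 0 < e1 by rewrite divr_gt0// exprn_gt0.
have [I [h [L [eta [eta0 hL he]]]]] := rellich_functionals M0 e1p.
exists I, (fun i Psi => inner (vd Psi).1 (h i)), L, eta; split => //.
  move=> i Psi /vdP; case: (vd Psi) => v d [Gv _ gM _]; exact: hL Gv gM.
move=> P P' /vdP + /vdP; case: (vd P) => v d; case: (vd P') => v' d' /=.
move=> [Gv /dvE dP gM dM] [Gv' /dvE dP' gM' dM'] hv.
have vv := he _ _ _ _ Gv Gv' gM gM' hv.
rewrite -ler_sqr ?nnegrE ?(ltW e0)// -inner_norm innerBr.
rewrite (dP _ _ (GB Gv Gv')) (dP' _ _ (GB Gv Gv')) opprK addrC -innerBr.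
rewrite (le_trans (ler_norm _))// (le_trans (inner_le_norm _ _))//.
rewrite (@le_trans _ _ (e1 * (M + M + 1)))//; last by rewrite /e1 divfK// gt_eqF.
rewrite ler_pM// (le_trans (ler_normB _ _))//.
by apply: (@le_trans _ _ (M + M)); [exact: lerD|rewrite lerDl].
Qed.

End abstract_operators.

(** * Completeness of L2 *)

Section L2_facts.
Context d (T : measurableType d) (R : realType).
Variable mu : {measure set T -> \bar R}.
Local Notation L2 := (LspaceType2 mu).
Implicit Types (u v : L2) (f g : T -> R).

Lemma L2_innerE_ae u v f g : measurable_fun setT f -> measurable_fun setT g ->
  L2fun u = f %[ae mu] -> L2fun v = g %[ae mu] ->
  inner u v = \int[mu]_x (f x * g x).
Proof.
move=> mf mg uf vg; rewrite L2_innerE; congr fine; apply: ae_eq_integral => //.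
- by apply/measurable_EFinP; apply: measurable_funM; exact: L2_measurable.
- by apply/measurable_EFinP; apply: measurable_funM.
by apply: filterS2 uf vg => x + + _ => /(_ I) + /(_ I); rewrite /L2fun => -> ->.
Qed.

Lemma L2_sqr_normE_ae u f : measurable_fun setT f -> L2fun u = f %[ae mu] ->
  (`|u| ^+ 2)%:E = (\int[mu]_x (f x ^+ 2)%:E)%E.
Proof.
move=> mf uf; rewrite -inner_norm L2_innerE /Rintegral fineK; last first.
  exact: (integrable_fin_num measurableT (L2_integrable u u)).
apply: ae_eq_integral => //.
- by apply/measurable_EFinP; apply: measurable_funM; exact: L2_measurable.
- by apply/measurable_EFinP; exact: measurable_funX.
by apply: filterS uf => x + _ => /(_ I); rewrite /L2fun => ->; rewrite expr2.
Qed.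

Lemma Lfun2P f : measurable_fun setT f ->
  (\int[mu]_x (f x ^+ 2)%:E < +oo)%E -> f \in Lfun mu 2%:E.
Proof.
move=> mf If; rewrite inE; apply/andP; split; rewrite inE//=.
rewrite /finite_norm unlock /Lnorm poweR_lty//.
apply: le_lt_trans If; apply: ge0_le_integral => //=.
- apply/measurable_EFinP/(@measurableT_comp _ _ _ _ _ _ (fun x : R => x `^ 2)%R) => //.
  exact/measurableT_comp.
- by apply/measurable_EFinP; exact: measurable_funX.
by move=> x _; rewrite lee_fin powR_mulrn// real_normK ?num_real.
Qed.

Lemma L2funB u v : L2fun (u - v) = (fun x => u x - v x) %[ae mu].
Proof.
apply: filterS2 (L2funD u (- v)) (L2funZ (-1) v) => x.
move=> + + _ => /(_ I) + /(_ I); rewrite scaleN1r /L2fun => -> ->.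
by rewrite mulN1r.
Qed.

(* The weights 4^k make sum_k 4^k |f_k - f_{k+1}|^2 integrable; where it is finite,
   |f_k - f_{k+1}| is bounded by a multiple of 2^-k.  Fatou bounds the distance
   to the pointwise limit. *)
Lemma L2_rapid_cauchy (u : nat -> L2) :
  (forall k m, (k <= m)%N -> `|u k - u m| <= 4 ^- k) ->
  exists l, forall k, `|u k - l| <= 4 ^- k.
Proof.
move=> uC; pose f k : T -> R := L2fun (u k).
have mf k : measurable_fun setT (f k) by exact: L2_measurable.
have mfB k m : measurable_fun setT (fun x =>
  f k x - f m x) by exact: (measurable_funB (mf k) (mf m)).
have fB k m : (`|u k - u m| ^+ 2)%:E = (\int[mu]_x ((f k x - f m x) ^+ 2)%:E)%E.
  by apply: L2_sqr_normE_ae (L2funB _ _); exact: mfB.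
pose dl k x : \bar R := (4 ^+ k * (f k x - f k.+1 x) ^+ 2)%:E.
have mdl k : measurable_fun setT (dl k).
  by apply/measurable_EFinP; exact: (measurable_funM (measurable_cst _)
    (measurable_funX 2 (mfB _ _))).
have dl0 k x : (0 <= dl k x)%E by rewrite lee_fin mulr_ge0 ?sqr_ge0 ?exprn_ge0.
have S_lty : (\int[mu]_x (\sum_(k <oo) dl k x) < +oo)%E.
  rewrite integral_nneseries//.
  apply: (@le_lt_trans _ _ 2%:E); last exact: ltry.
  apply: (@le_trans _ _ (\sum_(k <oo) (2 / (2 ^ k.+1)%:R)%:E)%E);
    last exact: epsilon_trick0.
  (* The k-th term is at most 4^k (4^-k)^2 = 4^-k, which is below 2^-k = 2 / 2^(k+1). *)
  apply: lee_nneseries => k _; first by move=> *; apply: integral_ge0 => x _; exact: dl0.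
  rewrite /dl; under eq_integral do rewrite EFinM.
  rewrite ge0_integralZl//; last 2 first.
  - by apply/measurable_EFinP; exact: (measurable_funX 2 (mfB _ _)).
  - by move=> x _; rewrite lee_fin sqr_ge0.
  rewrite -fB -EFinM lee_fin.
  rewrite (@le_trans _ _ (4 ^+ k * (4 ^- k) ^+ 2))//.
    by rewrite ler_wpM2l ?exprn_ge0// ler_sqr ?nnegrE ?invr_ge0 ?exprn_ge0// uC.
  rewrite expr2 mulrA divff ?mul1r ?gt_eqF ?exprn_gt0//.
  by rewrite expnS natrM invfM mulrA divff// mul1r natrX lef_pV2 ?posrE ?exprn_gt0//;
    apply: lerXn2r; rewrite ?nnegrE ?ler_nat.
have ae_fin : {ae mu, forall x, \sum_(k <oo) dl k x \is a fin_num}%E.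
  have : mu.-integrable setT (fun x => \sum_(k <oo) dl k x)%E.
    apply/integrableP; split; first exact: ge0_emeasurable_sum.
    under eq_integral => x _ do rewrite gee0_abs ?nneseries_ge0//.
    exact: S_lty.
  move=> /(integrable_ae measurableT); apply: filterS => x; exact.
have ae_cvg : {ae mu, forall x, cvgn (fun k => f k x)}.
  apply: filterS ae_fin => x Sx.
  pose s := fine (\sum_(k <oo) dl k x)%E.
  have s0 : 0 <= s by apply: fine_ge0; exact: nneseries_ge0.
  have fs k : `|f k.+1 x - f k x| <= (s + 1) / 2 ^+ k.
    have : (dl k x <= s%:E)%E.
      rewrite fineK//; apply: le_trans (nneseries_lim_ge k.+1 _) => //.
      by rewrite big_nat_recr//= leeDr// sume_ge0.
    rewrite lee_fin mulrC -ler_pdivlMr ?exprn_gt0// distrC => fks.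
    rewrite -ler_sqr ?nnegrE ?divr_ge0 ?exprn_ge0 ?addr_ge0//.
    rewrite real_normK ?num_real// (le_trans fks)//.
    rewrite expr_div_n -exprM mulnC exprM (_ : 2 ^+ 2 = 4); last by ring.
    by rewrite ler_wpM2r ?invr_ge0 ?exprn_ge0//; nra.
  have cT : cvgn (series (telescope (fun k => f k x))).
    apply: normed_cvg; apply: (@series_le_cvg _ _ (geometric (s + 1) 2^-1)) => //.
    - by move=> k; rewrite /= normr_ge0.
    - by move=> k; rewrite /geometric/= mulr_ge0 ?exprn_ge0 ?addr_ge0 ?invr_ge0.
    - by move=> k; rewrite /geometric/= exprVn; exact: fs.
    apply: is_cvg_geometric_series; rewrite ger0_norm ?invr_ge0// invf_lt1//.
    by rewrite ltr1n.
  rewrite (_ : (fun k => f k x) = (fun k => f 0 x + series (telescope (fun k =>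
    f k x)) k)); last first.
    by apply/funext => k; rewrite -(eq_sum_telescope (fun k => f k x)).
  by apply: is_cvgD => //; exact: is_cvg_cst.
(* The limit superior makes [F] measurable on the whole space; it agrees with the pointwise limit
   almost everywhere. *)
pose F x := fine (limn_esup (fun k => (f k x)%:E)).
have mF : measurable_fun setT F.
  apply: measurableT_comp => //; apply: measurable_fun_limn_esup => k.
  exact/measurable_EFinP.
have ae_lim : {ae mu, forall x, (fun k => f k x) @ \oo --> F x}.
  apply: filterS ae_cvg => x fx; rewrite /F.
  have /cvg_limn_einf_sup[_ ->//] : (fun k => (f k x)%:E) @ \oo --> (limn (fun k =>
    f k x))%:E.
  by apply: cvg_EFin => //; exact: nearW.
have FB m : (\int[mu]_x ((f m x - F x) ^+ 2)%:E <= ((4 ^- m) ^+ 2)%:E)%E.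
  pose g k x : \bar R := ((f m x - f k x) ^+ 2)%:E.
  have mg k : measurable_fun setT (g k).
    by apply/measurable_EFinP; exact: (measurable_funX 2 (mfB _ _)).
  have g0 k x : (0 <= g k x)%E by rewrite lee_fin sqr_ge0.
  apply: (@le_trans _ _ (\int[mu]_x limn_einf (g^~ x))%E); last first.
    apply: (le_trans (fatou mu measurableT mg (fun k x _ => g0 k x))).
    rewrite limn_einf_lim; apply: lime_le; first exact: is_cvg_einfs.
    (* The bound 4^-m on |u_m - u_j| requires m <= j, hence the index [maxn m k]. *)
    near=> k; apply: ereal_inf_le; exists (\int[mu]_x g (maxn m k) x)%E.
      by exists (maxn m k) => //=; exact: leq_maxr.
    by rewrite -fB lee_fin ler_sqr ?nnegrE ?invr_ge0 ?exprn_ge0// uC// leq_maxl.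
  rewrite le_eqVlt; apply/orP; left; apply/eqP; apply: ge0_ae_eq_integral => //.
  - by apply/measurable_EFinP; exact: (measurable_funX 2 (measurable_funB (mf m) mF)).
  - rewrite /limn_einf; apply: measurableT_comp => //.
    by apply: measurable_fun_limn_esup => k; exact: measurableT_comp.
  - by move=> x _; rewrite lee_fin sqr_ge0.
  - by move=> x _; rewrite limn_einf_lim; apply: lime_ge; [exact: is_cvg_einfs|
    apply: nearW => k; apply: le_ereal_inf_tmp => _ [j _ <-]; exact: g0].
  apply: filterS ae_lim => x fx _.
  have /cvg_limn_einf_sup[-> _//] : (g^~ x) @ \oo --> ((f m x - F x) ^+ 2)%:E.
  apply: cvg_EFin; first exact: nearW.
  by apply: cvgM; apply: cvgB => //; exact: cvg_cst.
(* Square integrability is available for [f 0 - F], through [FB 0]; the limit is recovered by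
   subtracting its class from [u 0]. *)
have hL : (fun x => f 0 x - F x) \in Lfun mu 2%:E.
  apply: Lfun2P; first exact: (measurable_funB (mf 0) mF).
  by apply: le_lt_trans (FB 0) _; rewrite ltry.
pose l := u 0 - toL2 hL.
exists l => k; rewrite -ler_sqr ?nnegrE ?invr_ge0 ?exprn_ge0//.
rewrite -lee_fin (@L2_sqr_normE_ae _ (fun x => f k x - F x))//;
  first exact: (measurable_funB (mf k) mF).
apply: filterS3 (L2funB (u k) l) (L2funB (u 0) (toL2 hL)) (toL2K hL) => x.
move=> + + + _ => /(_ I) + /(_ I) + /(_ I).
rewrite /f /L2fun => -> -> ->. ring.
Unshelve. all: by end_near.
Qed.

(** Reduces a Cauchy filter to a sequence: [u k] is taken in the intersection of the sets [A j] with
    j <= k, the j-th of diameter at most 4^-j. The intersections make the sequence rapidly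
    Cauchy. *)
Lemma L2_complete : hilbert_complete L2.
Proof.
move=> F FF FC.
have e0 k : 0 < 4 ^- k :> R by rewrite invr_gt0 exprn_gt0.
have AE : forall k, exists A, F A /\ forall x y : L2, A x -> A y -> `|x - y| <= 4 ^- k.
  by move=> k; have [A] := FC _ (e0 k); exists A.
have [A AP] := choice AE.
pose B k := \bigcap_(j in [set j | (j <= k)%N]) A j.
have FB k : F (B k).
  elim: k => [|k IH].
    apply: filterS (AP 0).1 => x Ax j /=; by rewrite leqn0 => /eqP ->.
  apply: filterS2 IH (AP k.+1).1 => x Bx Ax j /=.
  by rewrite leq_eqVlt => /predU1P[->//|jk]; exact: Bx.
have uE k : exists x, B k x by exact: filter_ex (FB k).
have [u uB] := choice uE.
have [l lP] : exists l, forall k, `|u k - l| <= 4 ^- k.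
  apply: L2_rapid_cauchy => k m km; apply: (AP k).2;
    [exact: (uB k k (leqnn k)) | exact: (uB m k km)].
exists l; apply: filter_dist_cvg => e ep.
have [k ke] : exists k, 4 ^- k + 4 ^- k <= e.
  have [k _ /(_ k (leqnn k)) /= ke] := near_infty_natSinv_expn_lt (PosNum (divr_gt0 ep
    (ltr0Sn R 1))).
  exists k; rewrite [leRHS]splitr; suff : 4 ^- k <= e / 2 by move=> h; exact: lerD.
  apply: le_trans (ltW ke); rewrite div1r lef_pV2 ?posrE ?exprn_gt0//.
  by apply: lerXn2r; rewrite ?nnegrE ?ler_nat.
exists (A k) => [|x Ax]; first exact: (AP k).1.
rewrite (le_trans _ ke)// (le_trans (ler_distD (u k) _ _))// lerD//.
  by rewrite distrC.
by apply: (AP k).2 => //; exact: (uB k k (leqnn k)).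
Qed.

End L2_facts.

(** * Bounded functions supported in a box *)

(** The discriminant criterion behind the Cauchy-Schwarz inequality for integrals. *)
Lemma sqr_le_quadratic (R : realFieldType) (F P Q : R) : 0 <= F -> 0 <= Q ->
  (forall s, 0 <= F - 2 * s * P + s ^+ 2 * Q) -> P ^+ 2 <= F * Q.
Proof.
move=> F0 Q0 key.
have [Qe|Qn] := eqVneq Q 0.
  have [->|Pn] := eqVneq P 0; first by rewrite expr0n mulr_ge0.
  (* At this [s] the quadratic takes the value F - (F + 1) = -1. *)
  have := key ((F + 1) / (2 * P)); rewrite Qe mulr0 addr0.
  have -> : 2 * ((F + 1) / (2 * P)) * P = F + 1 by field.
  lra.
have Qp : 0 < Q by rewrite lt_neqAle eq_sym Qn.
have := key (P / Q); rewrite -(pmulr_rge0 _ Qp) (_ : Q * _ = F * Q - P ^+ 2); last by field.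
by rewrite subr_ge0.
Qed.

Section bounded_integrands.
Context d (T : measurableType d) (R : realType).
Variables (mu : {measure set T -> \bar R}) (B : set T).
Hypotheses (mB : measurable B) (fB : (mu B < +oo)%E).
Implicit Types f g : T -> R.

(** A class closed under sums and products whose members are integrable when [B] has finite measure;
    on it the integral is linear and monotone without separate integrability conditions. *)
Definition bdd_on f := [/\ measurable_fun setT f,
  exists M, forall x, `|f x| <= M & forall x, ~ B x -> f x = 0].

Lemma bdd_on_integrable f : bdd_on f -> mu.-integrable setT (EFin \o f).
Proof.
move=> [mf [M fM] f0]; have : mu.-integrable B (EFin \o f).
  apply: measurable_bounded_integrable => //; first exact: measurable_funTS.
  exists M; split; first exact: num_real.
  by move=> N MN x _ /=; rewrite (le_trans (fM x))// ltW.
move=> /(integrable_mkcond _ mB); rewrite (_ : _ \_ B = EFin \o f)//.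
apply/funext => x; rewrite patchE; case: ifPn => //; rewrite notin_setE => /f0 /= ->.
by [].
Qed.

Lemma bdd_onD f g : bdd_on f -> bdd_on g -> bdd_on (fun x => f x + g x).
Proof.
move=> [mf [M fM] f0] [mg [N gN] g0]; split; first exact: measurable_funD.
  by exists (M + N) => x; rewrite (le_trans (ler_normD _ _))// lerD.
by move=> x Bx; rewrite f0// g0// addr0.
Qed.

Lemma bdd_onMr f g : bdd_on f -> measurable_fun setT g ->
  (exists M, forall x, `|g x| <= M) -> bdd_on (fun x => f x * g x).
Proof.
move=> [mf [M fM] f0] mg [N gN]; split; first exact: measurable_funM.
  by exists (M * N) => x; rewrite normrM ler_pM.
by move=> x Bx; rewrite f0// mul0r.
Qed.

Lemma bdd_onM f g : bdd_on f -> bdd_on g -> bdd_on (fun x => f x * g x).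
Proof. by move=> ff [mg gM _]; exact: bdd_onMr. Qed.

Lemma bdd_onZ a f : bdd_on f -> bdd_on (fun x => a * f x).
Proof.
move=> ff; under eq_fun do rewrite mulrC.
by apply: bdd_onMr => //; exists `|a|.
Qed.

Lemma bdd_onX2 f : bdd_on f -> bdd_on (fun x => f x ^+ 2).
Proof. by move=> ff; under eq_fun do rewrite expr2; exact: bdd_onM. Qed.

Lemma bdd_on0 : bdd_on (fun=> 0).
Proof. by split=> //; exists 0 => x; rewrite normr0. Qed.

Lemma bdd_onB f g : bdd_on f -> bdd_on g -> bdd_on (fun x => f x - g x).
Proof.
by move=> ff /(bdd_onZ (-1)) gg; under eq_fun do rewrite -mulN1r; exact: bdd_onD.
Qed.

Lemma bdd_on_sum (I : Type) (s : seq I) (F : I -> T -> R) : (forall i, bdd_on (F i)) ->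
  bdd_on (fun x => \sum_(i <- s) F i x).
Proof.
move=> FB; elim: s => [|i s IH].
  by under eq_fun do rewrite big_nil; exact: bdd_on0.
by under eq_fun do rewrite big_cons; exact: bdd_onD.
Qed.

Local Notation Int f := (\int[mu]_x f x).

Lemma bdd_intD f g : bdd_on f -> bdd_on g ->
  \int[mu]_x (f x + g x) = Int f + Int g.
Proof. by move=> ff gg; rewrite RintegralD//; exact: bdd_on_integrable. Qed.

Lemma bdd_intB f g : bdd_on f -> bdd_on g ->
  \int[mu]_x (f x - g x) = Int f - Int g.
Proof. by move=> ff gg; rewrite RintegralB//; exact: bdd_on_integrable. Qed.

Lemma bdd_intZ a f : bdd_on f -> \int[mu]_x (a * f x) = a * Int f.
Proof. by move=> ff; rewrite RintegralZl//; exact: bdd_on_integrable. Qed.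

Lemma bdd_int_le f g : bdd_on f -> bdd_on g -> (forall x, f x <= g x) -> Int f <= Int g.
Proof. by move=> ff gg fg; apply: le_Rintegral => //; exact: bdd_on_integrable. Qed.

Lemma bdd_int_sum (I : Type) (s : seq I) (F : I -> T -> R) : (forall i, bdd_on (F i)) ->
  \int[mu]_x (\sum_(i <- s) F i x) = \sum_(i <- s) Int (F i).
Proof.
move=> FB; elim: s => [|i s IH].
  by rewrite big_nil -[RHS](mul0r (\int[mu]_x 0)) -bdd_intZ;
    [apply: eq_Rintegral => x _; rewrite big_nil mul0r | exact: bdd_on0].
rewrite big_cons -IH -bdd_intD//; last exact: bdd_on_sum.
by apply: eq_Rintegral => x _; rewrite big_cons.
Qed.

Lemma int_ge0 f : (forall x, 0 <= f x) -> 0 <= Int f.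
Proof. by move=> f0; apply: Rintegral_ge0 => x _. Qed.

Lemma bdd_on_indic : bdd_on \1_B.
Proof.
split; first exact: measurable_indic.
  by exists 1 => x; rewrite indicE; case: (_ \in _); rewrite ?normr1 ?normr0.
by move=> x Bx; rewrite indicE memNset.
Qed.

Lemma int_indic : Int \1_B = fine (mu B).
Proof. by rewrite /Rintegral integral_indic// setIT. Qed.

Lemma bdd_int_norm f M : bdd_on f -> (forall x, `|f x| <= M) ->
  `|Int f| <= M * fine (mu B).
Proof.
move=> ff fM; rewrite -int_indic -(bdd_intZ _ bdd_on_indic).
have [mf _ f0] := ff.
apply: le_trans (le_normr_Rintegral _ (bdd_on_integrable ff)) _ => //.
apply: bdd_int_le.
- split; first exact: measurableT_comp.
    by exists M => x; rewrite normr_id.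
  by move=> x /f0 ->; rewrite normr0.
- by apply: bdd_onZ; exact: bdd_on_indic.
move=> x; rewrite indicE; have [Bx|Bx] := pselect (B x); first by rewrite mem_set// mulr1.
by rewrite memNset// mulr0 f0// normr0.
Qed.

Lemma bdd_int_CS f g : bdd_on f -> bdd_on g ->
  (\int[mu]_x (f x * g x)) ^+ 2 <= (\int[mu]_x (f x ^+ 2)) * (\int[mu]_x (g x ^+ 2)).
Proof.
move=> ff gg; set P := \int[mu]_x (f x * g x).
set F := \int[mu]_x (f x ^+ 2); set Q := \int[mu]_x (g x ^+ 2).
have key s : 0 <= F - 2 * s * P + s ^+ 2 * Q.
  have : 0 <= \int[mu]_x ((f x - s * g x) ^+ 2) by apply: int_ge0 => x; exact: sqr_ge0.
  rewrite (_ : \int[mu]_x _ = \int[mu]_x ((f x ^+ 2 - (2 * s) * (f x * g x)) + s ^+ 2 *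
    g x ^+ 2)).
    rewrite bdd_intD; last 2 first.
    - by apply: bdd_onB; [exact: bdd_onX2|apply: bdd_onZ; exact: bdd_onM].
    - by apply: bdd_onZ; exact: bdd_onX2.
    rewrite bdd_intB; last 2 first.
    - exact: bdd_onX2.
    - by apply: bdd_onZ; exact: bdd_onM.
    by rewrite !bdd_intZ//; [exact: bdd_onX2|exact: bdd_onM].
  by apply: eq_Rintegral => x _; ring.
by apply: sqr_le_quadratic => //; apply: int_ge0 => x; exact: sqr_ge0.
Qed.

End bounded_integrands.

(** * Cubes, and Fubini's theorem along the first coordinate *)

Section box.
Context (R : realType) (L : R).
Local Notation T1 := (measurableTypeR R).

Definition box n : set 'rV[R]_n := [set x | forall i, x 0 i \in `[- L, L]].
Definition segm : set T1 := [set` `[- L, L]].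

Lemma measurable_segm : measurable segm.
Proof. exact: measurable_itv. Qed.

Lemma segm_fin : (lebesgue_measure segm < +oo)%E.
Proof. by rewrite /segm lebesgue_measure_itv/=; case: ifP => _;
  rewrite ?ltry// -EFinB ltry. Qed.

Lemma measurable_box n : measurable (@box n).
Proof.
rewrite (_ : @box n = \bigcap_(i in [set: 'I_n]) ((fun x : 'rV[R]_n => x 0 i) @^-1` segm)).
  apply: fin_bigcap_measurable => // i _; rewrite -[X in measurable X]setTI.
  exact: measurable_coord measurable_segm.
by apply/seteqP; split=> [x Bx i _|x Bx i]; exact: Bx.
Qed.

Lemma box_fin n : (lebesgue_rV R n (@box n) < +oo)%E.
Proof.
rewrite (@lebesgue_rV_box R n (fun=> segm)); last by move=> _; exact: measurable_segm.
suff /andP[_ //] : (0 <= (\prod_(i < n) lebesgue_measure segm : \bar R) < +oo)%E.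
elim/big_ind : _ => [|x y /andP[x0 xoo] /andP[y0 yoo]|i _].
- by rewrite lee01 ltry.
- by rewrite mule_ge0//= lte_mul_pinfty// ge0_fin_numE.
by rewrite measure_ge0 segm_fin.
Qed.

Lemma bdd_box_integrable n (f : 'rV[R]_n -> R) : bdd_on (@box n) f ->
  (lebesgue_rV R n).-integrable setT (EFin \o f).
Proof. by apply: bdd_on_integrable; [exact: measurable_box|exact: box_fin]. Qed.

Lemma bdd_segm_integrable (f : R -> R) : bdd_on segm f ->
  (@lebesgue_measure R).-integrable setT (EFin \o f).
Proof. by apply: bdd_on_integrable; [exact: measurable_segm|exact: segm_fin]. Qed.

Lemma box_rV_cons n t (y : 'rV[R]_n) : box (rV_cons (t, y)) <-> segm t /\ box y.
Proof.
split=> [H|[H1 H2] i].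
  split; first by have := H 0; rewrite rV_cons0.
  by move=> i; have := H (lift 0 i); rewrite rV_consS.
by case: (unliftP 0 i) => [j|] ->; rewrite ?rV_consS ?rV_cons0//; exact: H2.
Qed.

Context (n : nat).
Local Notation bdd1 := (bdd_on segm).
Local Notation bddn := (bdd_on (@box n)).
Local Notation bddS := (bdd_on (@box n.+1)).
Local Notation mun := (lebesgue_rV R n).
Local Notation muS := (lebesgue_rV R n.+1).
Local Notation mu1 := (@lebesgue_measure R).
Implicit Type f : 'rV[R]_n.+1 -> R.

Lemma bdd_slice_tail f t : bddS f -> bddn (fun y => f (rV_cons (t, y))).
Proof.
move=> [mf [M fM] f0]; split.
- apply: measurableT_comp => //; apply: measurableT_comp (@measurable_rV_cons _ _) _.
  exact: pair1_measurable.
- by exists M => y.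
by move=> y By; apply: f0 => /box_rV_cons[].
Qed.

Lemma bdd_slice_head f y : bddS f -> bdd1 (fun t => f (rV_cons (t, y))).
Proof.
move=> [mf [M fM] f0]; split.
- apply: measurableT_comp => //; apply: measurableT_comp (@measurable_rV_cons _ _) _.
  exact: pair2_measurable.
- by exists M => t.
by move=> t Bt; apply: f0 => /box_rV_cons[].
Qed.

Let bdd_prod f : bddS f -> (mu1 \x mun)%E.-integrable setT (EFin \o (f \o @rV_cons R n)).
Proof.
move=> [mf [M fM] f0]; apply: (@bdd_on_integrable _ _ _ _ (segm `*` @box n)).
- by apply: measurableX; [exact: measurable_segm|exact: measurable_box].
- have : ((mu1 \x mun)%E (segm `*` @box n) < +oo)%E.
    rewrite product_measure1E; [|exact: measurable_segm|exact: measurable_box].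
    by rewrite lte_mul_pinfty ?ge0_fin_numE ?segm_fin ?box_fin.
  by [].
split.
- exact: measurableT_comp (@measurable_rV_cons _ _).
- by exists M => p /=.
by move=> [t y] Bp; apply: f0 => /box_rV_cons.
Qed.

Lemma bdd_int_tail f : bddS f -> bdd1 (fun t => \int[mun]_y f (rV_cons (t, y))).
Proof.
move=> Bf; have [mf [M fM] f0] := Bf; split.
- apply: measurableT_comp => //.
  exact: (measurable_fubini_F (bdd_prod Bf)).
- exists (M * fine (mun (@box n))) => t; apply: bdd_int_norm => //.
  + exact: measurable_box.
  + exact: box_fin.
  + exact: bdd_slice_tail.
move=> t Bt; rewrite /Rintegral integral0_eq// => y _.
by rewrite f0// => /box_rV_cons[].
Qed.

Lemma bdd_int_head f : bddS f -> bddn (fun y => \int[mu1]_t f (rV_cons (t, y))).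
Proof.
move=> Bf; have [mf [M fM] f0] := Bf; split.
- apply: measurableT_comp => //.
  exact: (measurable_fubini_G (bdd_prod Bf)).
- exists (M * fine (mu1 segm)) => t; apply: bdd_int_norm => //.
  + exact: measurable_segm.
  + exact: segm_fin.
  + exact: bdd_slice_head.
move=> t Bt; rewrite /Rintegral integral0_eq// => y _.
by rewrite f0// => /box_rV_cons[].
Qed.

Let int_prod f : bddS f -> (\int[muS]_x (f x)%:E = \int[mu1 \x mun]_p (f (rV_cons p))%:E)%E.
Proof.
move=> Bf; have [mf _ _] := Bf.
have := @integral_pushforward _ _ _ _ R (@rV_cons R n) (@measurable_rV_cons R n)
  (mu1 \x mun)%E setT (EFin \o f).
rewrite preimage_setT; apply => //; first exact/measurable_EFinP.
exact: bdd_prod.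
Qed.

(** Here the last n coordinates are integrated first, the order for induction on the dimension. In
    [fubini_head] the first coordinate comes first, so that the fundamental theorem of calculus
    applies. *)
Lemma fubini_tail f : bddS f ->
  \int[muS]_x f x = \int[mu1]_t (\int[mun]_y f (rV_cons (t, y))).
Proof.
move=> Bf; rewrite {1}/Rintegral int_prod// -integral12_prod_meas1/=; last exact: bdd_prod.
congr fine; apply: eq_integral => t _; rewrite /fubini_F /Rintegral fineK//.
apply: integrable_fin_num => //.
exact: (bdd_box_integrable (bdd_slice_tail t Bf)).
Qed.

Lemma fubini_head f : bddS f ->
  \int[muS]_x f x = \int[mun]_y (\int[mu1]_t f (rV_cons (t, y))).
Proof.
move=> Bf; rewrite {1}/Rintegral int_prod// -integral21_prod_meas1/=; last exact: bdd_prod.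
congr fine; apply: eq_integral => t _; rewrite /fubini_G /Rintegral fineK//.
apply: integrable_fin_num => //.
exact: (bdd_segm_integrable (bdd_slice_head t Bf)).
Qed.

End box.

(** * Partial derivatives and integration by parts *)

Section one_dim.
Context (R : realType).
Local Notation mu1 := (@lebesgue_measure R).

Lemma FTC_indic (g g' : R -> R) (a b : R) : a <= b -> continuous g -> continuous g' ->
  (forall t : R, is_derive t (1 : R) g (g' t)) ->
  \int[mu1]_t (\1_(`[a, b]) t * g' t) = g b - g a.
Proof.
move=> ab cg cg' dg.
have -> : \int[mu1]_t (\1_(`[a, b]) t * g' t) = \int[mu1]_(t in `[a, b]) g' t.
  rewrite [RHS]Rintegral_mkcond; apply: eq_Rintegral => t _.
  by rewrite indicE patchE; case: ifPn => _; rewrite ?mul1r ?mul0r.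
move: ab; rewrite le_eqVlt => /predU1P[->|ab].
  by rewrite set_itv1 Rintegral_set1 subrr.
rewrite /Rintegral (@continuous_FTC2 _ g' g)//.
- exact: continuous_subspaceT.
- split=> [t _||]; first exact: (@ex_derive _ _ _ _ _ _ _ (dg t)).
  + by apply: cvg_at_right_filter; exact: cg.
  + by apply: cvg_at_left_filter; exact: cg.
by move=> t _; rewrite derive1E derive_val.
Qed.

End one_dim.

Section slices.
Context (R : realType) (n : nat).
Implicit Types (f : 'rV[R]_n.+1 -> R) (y : 'rV[R]_n).

Lemma rV_cons_addr h j t y : rV_cons (t, h *: delta_mx 0 j + y) =
  h *: delta_mx 0 (lift 0 j) + rV_cons (t, y).
Proof.
apply/rowP => i; rewrite [RHS]mxE; case: (unliftP 0 i) => [k|] ->.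
  by rewrite !rV_consS !mxE (inj_eq lift_inj).
by rewrite !rV_cons0 !mxE (negbTE (neq_lift _ _)) andbF mulr0 add0r.
Qed.

Lemma rV_cons_addl (h t : R) y : rV_cons (h *: (1 : R^o) + t, y) =
  h *: delta_mx 0 0 + rV_cons (t, y).
Proof.
apply/rowP => i; rewrite [RHS]mxE; case: (unliftP 0 i) => [k|] ->.
  by rewrite !rV_consS/= !mxE/= mulr0 add0r.
by rewrite !rV_cons0 !mxE/=.
Qed.

Lemma continuous_rV_consr t : continuous (fun y => rV_cons (t, y)).
Proof.
move=> y U /nbhs_ballP[e e0 eU]; apply/nbhs_ballP; exists e => // z yz; apply: eU.
split=> // i k; rewrite (ord1 i); case: (unliftP 0 k) => [j|] ->.
  by rewrite !rV_consS; have [_] := yz; exact.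
by rewrite !rV_cons0; exact: ballxx.
Qed.

Lemma continuous_rV_consl y : continuous (fun t : R => rV_cons (t, y)).
Proof.
move=> t U /nbhs_ballP[e e0 eU]; apply/nbhs_ballP; exists e => // z yz; apply: eU.
split=> // i k; rewrite (ord1 i); case: (unliftP 0 k) => [j|] ->.
  by rewrite !rV_consS; exact: ballxx.
by rewrite !rV_cons0.
Qed.

(** A shift along a basis vector in the slice is a shift along the lifted basis vector, so the two
    difference quotients are the same function of [h]. *)
Lemma is_derive_slice_tail f t y j df :
  is_derive (rV_cons (t, y)) (delta_mx 0 (lift 0 j)) f df ->
  is_derive y (delta_mx 0 j) (fun z => f (rV_cons (t, z))) df.
Proof.
have E : (fun h : R => h^-1 *: (((fun z => f (rV_cons (t, z))) \o shift y) (h *: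
  delta_mx 0 j)
     - f (rV_cons (t, y)))) =
   (fun h : R => h^-1 *: ((f \o shift (rV_cons (t, y))) (h *: delta_mx 0 (lift 0 j))
     - f (rV_cons (t, y)))).
  by apply/funext => h /=; rewrite rV_cons_addr.
move=> [fd fv]; split; first by rewrite /derivable E.
by rewrite /derive E.
Qed.

Lemma is_derive_slice_head f (t : R) y df :
  is_derive (rV_cons (t, y)) (delta_mx 0 0) f df ->
  is_derive t 1 (fun s => f (rV_cons (s, y))) df.
Proof.
have E : (fun h : R => h^-1 *: (((fun s => f (rV_cons (s, y))) \o shift t) (h *: (1 : R^o))
     - f (rV_cons (t, y)))) =
   (fun h : R => h^-1 *: ((f \o shift (rV_cons (t, y))) (h *: delta_mx 0 0)
     - f (rV_cons (t, y)))).
  by apply/funext => h /=; rewrite rV_cons_addl.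
move=> [fd fv]; split; first by rewrite /derivable E.
by rewrite /derive E.
Qed.

End slices.

Section box_functions.
Context (R : realType) (L : R).

Definition cont_on_box n (f : 'rV[R]_n -> R) := [/\ continuous f,
  exists M, forall x, `|f x| <= M & forall x, ~ box L x -> f x = 0].

Lemma continuous_measurable_rV n (f : 'rV[R]_n -> R) : continuous f ->
  measurable_fun setT f.
Proof.
move=> cf; apply: (measurability _ (RGenOpens.measurableE R)).
move=> _ [_ [a [b ->] <-]]; rewrite setTI; apply: open_measurable_rV.
by move: cf => /continuousP; apply; exact: interval_open.
Qed.

Lemma cont_on_box_bdd n (f : 'rV[R]_n -> R) : cont_on_box f -> bdd_on (@box R L n) f.
Proof. by move=> [cf bf f0]; split => //; exact: continuous_measurable_rV. Qed.

(** The derivatives are part of the data: a slice belongs to the same class, with the family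
    reindexed by [lift 0]. *)
Definition C1_on_box n (f : 'rV[R]_n -> R) (df : 'I_n -> 'rV[R]_n -> R) :=
  [/\ cont_on_box f, forall i, cont_on_box (df i) &
      forall i x, is_derive x (delta_mx 0 i) f (df i x)].

Lemma cont_slice_tail n (f : 'rV[R]_n.+1 -> R) t : cont_on_box f ->
  cont_on_box (fun y => f (rV_cons (t, y))).
Proof.
move=> [cf [M fM] f0]; split.
- move=> y; apply: continuous_comp; [exact: continuous_rV_consr|exact: cf].
- by exists M => y.
by move=> y By; apply: f0 => /box_rV_cons[].
Qed.

Lemma C1_slice_tail n (f : 'rV[R]_n.+1 -> R) df t : C1_on_box f df ->
  C1_on_box (fun y => f (rV_cons (t, y))) (fun i y => df (lift 0 i) (rV_cons (t, y))).
Proof.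
move=> [cf cdf dfE]; split.
- exact: cont_slice_tail.
- by move=> i; exact: cont_slice_tail.
by move=> i x; apply: is_derive_slice_tail.
Qed.

(** A derivative in a later coordinate is treated slice by slice by induction; one in the first
    coordinate by the fundamental theorem of calculus between endpoints outside the cube. *)
Lemma int_partial0 n (f df : 'rV[R]_n -> R) i : cont_on_box f -> cont_on_box df ->
  (forall x, is_derive x (delta_mx 0 i) f (df x)) ->
  \int[lebesgue_rV R n]_x df x = 0.
Proof.
elim: n f df i => [|n IH] f df i cf cdf fd; first by case: i fd.
case: (unliftP 0 i) fd => [j|] -> fd.
  rewrite (fubini_tail (cont_on_box_bdd cdf)) /Rintegral integral0_eq// => t _.
  apply: (congr1 EFin); apply: (IH (fun y => f (rV_cons (t, y))) _ j).
  - exact: cont_slice_tail.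
  - exact: cont_slice_tail.
  by move=> y; exact: is_derive_slice_tail.
rewrite (fubini_head (cont_on_box_bdd cdf)) /Rintegral integral0_eq// => y _.
suff E : \int[@lebesgue_measure R]_t df (rV_cons (t, y)) = 0 by exact: (congr1 EFin E).
have [cf1 _ f0] := cf; have [cdf1 _ df0] := cdf.
have out (t : R) : `|L| < `|t| -> ~ box L (rV_cons (t, y)).
  move=> Lt /box_rV_cons[]; rewrite /segm/= in_itv/= -ler_norml => tL _.
  by have := lt_le_trans Lt (le_trans tL (ler_norm L)); rewrite ltxx.
(* Both [b] and [- b] lie strictly outside the cube, whatever the sign of [L]. *)
pose b := `|L| + 1.
have b0 : 0 <= b by rewrite addr_ge0.
have Lb : `|L| < `|b| by rewrite (ger0_norm b0) /b ltrDl.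
transitivity (\int[@lebesgue_measure R]_t (\1_(`[- b, b]) t * df (rV_cons (t, y)))).
  apply: eq_Rintegral => t _; rewrite indicE; case: (boolP (t \in _));
    first by rewrite mul1r.
  rewrite notin_setE/= in_itv/= -ler_norml => /negP; rewrite -ltNge => bt.
  by rewrite df0 ?mulr0//; apply: out; rewrite (lt_trans _ bt)// /b ltrDl.
have -> : \int[@lebesgue_measure R]_t (\1_(`[- b, b]) t * df (rV_cons (t, y))) =
    f (rV_cons (b, y)) - f (rV_cons (- b, y)).
  apply: (@FTC_indic _ (fun t => f (rV_cons (t, y)))).
  - by rewrite ge0_cp.
  - by move=> t; apply: continuous_comp; [exact: continuous_rV_consl|exact: cf1].
  - by move=> t; apply: continuous_comp; [exact: continuous_rV_consl|exact: cdf1].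
  by move=> t; exact: is_derive_slice_head.
rewrite (f0 _ (out _ Lb)) (f0 (rV_cons (- b, y))) ?subrr//.
by apply: out; rewrite normrN.
Qed.

(** Boundedness of [g] is asked on the cube alone, so that the linear function <y, x> qualifies. *)
Lemma cont_on_boxM n (f g : 'rV[R]_n -> R) : cont_on_box f -> continuous g ->
  (exists M, forall x, box L x -> `|g x| <= M) -> cont_on_box (fun x => f x * g x).
Proof.
move=> [cf [M fM] f0] cg [N gN]; split.
- by move=> x; apply: continuousM; [exact: cf|exact: cg].
- exists (`|M| * `|N|) => x; rewrite normrM.
  have [Bx|/f0 ->] := pselect (box L x); last by rewrite normr0 mul0r mulr_ge0.
  by rewrite ler_pM// ?(le_trans (fM x))// ?(le_trans (gN x Bx))// ler_norm.
by move=> x /f0 ->; rewrite mul0r.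
Qed.

Lemma cont_on_boxD n (f g : 'rV[R]_n -> R) : cont_on_box f -> cont_on_box g ->
  cont_on_box (fun x => f x + g x).
Proof.
move=> [cf [M fM] f0] [cg [N gN] g0]; split.
- by move=> x; apply: continuousD; [exact: cf|exact: cg].
- by exists (M + N) => x; rewrite (le_trans (ler_normD _ _))// lerD.
by move=> x Bx; rewrite f0// g0// addr0.
Qed.

End box_functions.

(** * Poincaré inequality *)

Lemma continuous_sum (R : realType) (T : topologicalType) (I : Type) (s : seq I) (F : I
  -> T -> R) :
  (forall i, continuous (F i)) -> continuous (fun x => \sum_(i <- s) F i x).
Proof.
move=> cF; elim: s => [|i s IH].
  by under eq_fun do rewrite big_nil; exact: cst_continuous.
under eq_fun do rewrite big_cons.
by move=> y; exact: (continuousD (cF i y) (IH y)).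
Qed.

Section poincare.
Context (R : realType) (L : R) (n : nat).
Local Notation mun := (lebesgue_rV R n).

Lemma continuous_dotR (x : 'rV[R]_n) : continuous (fun y : 'rV[R]_n => dotR y x).
Proof.
apply: continuous_sum => i y.
by apply: continuousM; [exact: coord_continuous|exact: cst_continuous].
Qed.

Lemma is_derive_dotR (x y : 'rV[R]_n) i :
  is_derive y (delta_mx 0 i) (fun z : 'rV[R]_n => dotR z x) (x 0 i).
Proof.
have E : (fun h : R => h^-1 *: (((fun z : 'rV[R]_n =>
  dotR z x) \o shift y) (h *: delta_mx 0 i) - dotR y x) : R) @ 0^' --> (x 0 i : R).
  apply: cvg_near_cst; apply: filterS (nbhs_dnbhs_neq (0 : R)) => h h0.
  rewrite /dotR/= -sumrB (bigD1 i)//= big1 => [|j ji].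
    by rewrite !mxE !eqxx/= addr0 mulrDl addrK mulr1 /GRing.scale/= mulKf.
  by rewrite !mxE (negbTE ji) andbF mulr0 add0r subrr.
split; first by apply/cvg_ex; exists (x 0 i).
exact: cvg_lim.
Qed.

(* The function <y, x> has derivative |x|^2 = 1 along x, so integrating
   the x-derivative of f^2 <y, x> gives
   int f^2 = - 2 int f <y, x> (D_x f), and AM-GM concludes. *)
Lemma poincare_C1 (f : 'rV[R]_n -> R) df (x : 'rV[R]_n) m : C1_on_box L f df ->
  dotR x x = 1 -> (forall y, f y != 0 -> `|dotR y x| <= m) ->
  \int[mun]_y (f y ^+ 2) <= 4 * m ^+ 2 * \sum_i \int[mun]_y (df i y ^+ 2).
Proof.
move=> [cf cdf fd] xx fm.
pose l y := dotR y x.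
(* The i-th partial derivative of f^2 l x_i; its first summand comes from the derivative x_i of
   [l]. *)
pose dh i y := f y ^+ 2 * (x 0 i ^+ 2) + 2 * (f y * df i y * (l y * x 0 i)).
have [M lM] : exists M, forall y, box L y -> `|l y| <= M.
  exists (\sum_i `|L| * `|x 0 i|) => y By; rewrite (le_trans (ler_norm_sum _ _ _))//.
  apply: ler_sum => i _; rewrite normrM ler_wpM2r//.
  by have := By i; rewrite in_itv/= -ler_norml => /le_trans; apply; exact: ler_norm.
have cl i : continuous (fun y => l y * x 0 i).
  by move=> y; apply: continuousM; [exact: continuous_dotR|exact: cst_continuous].
have lB i : exists M, forall y, box L y -> `|l y * x 0 i| <= M.
  by exists (M * `|x 0 i|) => y By; rewrite normrM ler_wpM2r// lM.
have cff g : cont_on_box L g -> cont_on_box L (fun y => f y * g y).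
  by move=> [cg [N gN] _]; apply: cont_on_boxM => //; exists N => y _.
have cst_box (a : R) g : cont_on_box L g -> cont_on_box L (fun y : 'rV[R]_n => g y * a).
  by move=> cg; apply: cont_on_boxM => //; [exact: cst_continuous|exists `|a|].
have cdh i : cont_on_box L (dh i).
  apply: cont_on_boxD.
    by apply: cst_box; under eq_fun do rewrite expr2; exact: cff.
  under eq_fun do rewrite mulrC; apply: cst_box.
  by apply: cont_on_boxM => //; exact: cff.
have dh0 i : \int[mun]_y dh i y = 0.
  apply: (@int_partial0 _ L n (fun y => f y * f y * (l y * x 0 i)) _ i) => //.
    by apply: cont_on_boxM => //; exact: cff.
  move=> y; rewrite /dh.
  have fy := fd i y; have ly := is_derive_dotR x y i.
  apply: (is_derive_eq (is_deriveM (is_deriveM fy fy) (is_deriveM ly (is_derive_cst (x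
    0 i) y _)))).
  change (f y * f y * (l y * 0 + x 0 i * x 0 i) + l y * x 0 i * (f y * df i y + f y *
    df i y) =
    f y ^+ 2 * x 0 i ^+ 2 + 2 * (f y * df i y * (l y * x 0 i))); ring.
have bf := cont_on_box_bdd cf; have bdf i := cont_on_box_bdd (cdf i).
have bdh i := cont_on_box_bdd (cdh i).
(* Summand by summand, right minus left is (F X + 2 l D)^2 / 2 + 2 (m^2 - l^2) D^2. The bound |l| <=
   m holds only where f is nonzero, hence the case F = 0. After integration the [dh] terms vanish
   and f^2 / 2 is absorbed, which gives 4 m^2. *)
have key y : f y ^+ 2 <= \sum_i dh i y + (2^-1 * f y ^+ 2 + (2 * m ^+ 2) * \sum_i df i
  y ^+ 2).
  have xx2 : \sum_i x 0 i ^+ 2 = 1.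
    by rewrite -xx; apply: eq_bigr => i _; rewrite expr2.
  have fx : f y ^+ 2 = \sum_i f y ^+ 2 * x 0 i ^+ 2 by rewrite -mulr_sumr xx2 mulr1.
  rewrite [leLHS]fx [X in 2^-1 * X]fx !mulr_sumr -!big_split/=.
  apply: ler_sum => i _; rewrite /dh.
  set X := x 0 i; set D := df i y; set F := f y.
  have [F0|F0] := eqVneq F 0.
    have : 0 <= m ^+ 2 * D ^+ 2 by rewrite mulr_ge0 ?sqr_ge0.
    rewrite F0; nra.
  have lm : l y ^+ 2 <= m ^+ 2.
    have := fm y F0; rewrite -/(l y) => H.
    by rewrite -real_normK ?num_real// lerXn2r// nnegrE// (le_trans _ H).
  have s0 := sqr_ge0 (F * X + 2 * (l y * D)).
  have s1 : 0 <= (m ^+ 2 - l y ^+ 2) * D ^+ 2 by rewrite mulr_ge0 ?sqr_ge0// subr_ge0.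
  nra.
have := bdd_int_le (@measurable_box R L n) (box_fin L n) (bdd_onX2 bf) _ key.
have bS : bdd_on (box L (n := n)) (fun y => \sum_i dh i y) by exact: bdd_on_sum.
have b2 : bdd_on (box L (n := n)) (fun y => 2^-1 * f y ^+ 2).
  by apply: bdd_onZ; exact: bdd_onX2.
have bd2 : bdd_on (box L (n := n)) (fun y => \sum_i df i y ^+ 2).
  by apply: bdd_on_sum => i; exact: bdd_onX2.
have b3 : bdd_on (box L (n := n)) (fun y => 2 * m ^+ 2 * \sum_i df i y ^+ 2) by exact:
  bdd_onZ.
have mB := @measurable_box R L n; have fB := box_fin L n.
rewrite (bdd_intD mB fB bS (bdd_onD b2 b3)) (bdd_intD mB fB b2 b3).
rewrite (bdd_int_sum mB fB)// (bdd_intZ mB fB _ (bdd_onX2 bf)) (bdd_intZ mB fB _ bd2).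
rewrite (bdd_int_sum mB fB) => [|i]; last exact: bdd_onX2.
rewrite (eq_bigr (fun=> 0)) => [|i _]; last exact: dh0.
rewrite big1// add0r => /(_ (bdd_onD bS (bdd_onD b2 b3))).
lra.
Qed.

End poincare.

(** * Rellich inequality *)

Section cells.
Context (R : realType) (L : R) (M : nat).
Hypotheses (L0 : 0 <= L) (M0 : (0 < M)%N).
Local Notation mu1 := (@lebesgue_measure R).
Local Notation T1 := (measurableTypeR R).

(* The length 2 L + 1 makes the half-open cells cover the closed segment. *)
Definition mesh : R := (2 * L + 1) / M%:R.
Definition node (k : nat) : R := - L + k%:R * mesh.
Definition cell (k : nat) : set T1 := [set` `[node k, node k.+1[ ].

Lemma mesh_gt0 : 0 < mesh.
Proof. by rewrite /mesh divr_gt0 ?ltr0n// ltr_wpDl ?mulr_ge0. Qed.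

Lemma node_le k : node k <= node k.+1.
Proof. by rewrite /node lerD2l ler_wpM2r ?ler_nat ?(ltW mesh_gt0). Qed.

Lemma nodeSB k : node k.+1 - node k = mesh.
Proof. by rewrite /node -natr1; ring. Qed.

Lemma measurable_cell k : measurable (cell k).
Proof. exact: measurable_itv. Qed.

Lemma cell_measure k : mu1 (cell k) = mesh%:E.
Proof.
rewrite /cell lebesgue_measure_itv/= lte_fin -EFinB nodeSB.
by rewrite -subr_gt0 nodeSB mesh_gt0.
Qed.

Lemma cell_fin k : (mu1 (cell k) < +oo)%E.
Proof. by rewrite cell_measure ltry. Qed.

(** A difference of two step functions, so that the sum over the cells telescopes. *)
Lemma indic_cell k t : \1_(cell k) t = (node k <= t)%R%:R - (node k.+1 <= t)%R%:R :> R.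
Proof.
rewrite indicE /cell; have := node_le k.
have -> : (t \in [set` `[node k, node k.+1[ ]) = (node k <= t < node k.+1).
  by rewrite mem_setE in_itv.
by case: (leP (node k) t); case: (leP (node k.+1) t) => //= h1 h2 h3; lra.
Qed.

Lemma sum_indic_cell t :
  \sum_(k < M) \1_(cell k) t = (- L <= t)%R%:R - (L + 1 <= t)%R%:R :> R.
Proof.
rewrite (eq_bigr _ (fun (k : 'I_M) _ => indic_cell k t)).
rewrite -(big_mkord xpredT (fun k => (node k <= t)%R%:R - (node k.+1 <= t)%R%:R)).
rewrite (eq_bigr (fun k => - ((node k.+1 <= t)%R%:R - (node k <= t)%R%:R)));
  last by move=> k _; rewrite opprB.
rewrite sumrN telescope_sumr// opprB /node mul0r addr0.
rewrite (_ : - L + M%:R * mesh = L + 1)//.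
by rewrite /mesh mulrCA divff ?mulr1 ?pnatr_eq0 -?lt0n//; ring.
Qed.

Lemma sum_indic_cell_le1 t : \sum_(k < M) \1_(cell k) t <= 1 :> R.
Proof.
by rewrite sum_indic_cell; case: (- L <= t); case: (L + 1 <= t) => /=; lra.
Qed.

Lemma sum_indic_cell_eq1 t : segm L t -> \sum_(k < M) \1_(cell k) t = 1 :> R.
Proof.
rewrite /segm/= in_itv/= => /andP[Lt tL]; rewrite sum_indic_cell Lt.
by rewrite [L + 1 <= t]leNgt (le_lt_trans tL) ?ltrDl// subr0.
Qed.

(* On the cell, psi differs from its average A by at most sqrt W. *)
Lemma cell_bound (psi : R -> R) W k : measurable_fun [set: T1] psi ->
  (exists N, forall t, `|psi t| <= N) ->
  (forall s t, cell k s -> cell k t -> (psi t - psi s) ^+ 2 <= W) ->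
  \int[mu1]_t (\1_(cell k) t * psi t ^+ 2) <=
    (\int[mu1]_t (\1_(cell k) t * psi t)) ^+ 2 / mesh + mesh * W.
Proof.
move=> mpsi bpsi psiW; set c : T1 -> R := \1_(cell k).
have d0 := mesh_gt0.
have mB := @measurable_cell k; have fB := cell_fin k.
have bc : bdd_on (cell k) c by exact: bdd_on_indic.
have cc t : c t * c t = c t by rewrite /c indicE; case: (_ \in _); rewrite ?mulr1 ?mulr0.
have bcpsi : bdd_on (cell k) (fun t => c t * psi t) by exact: bdd_onMr.
have intc : \int[mu1]_t c t = mesh.
  by rewrite (int_indic mu1 mB); exact: (congr1 fine (cell_measure k)).
set P := \int[mu1]_t (c t * psi t).
pose A := P / mesh.
have bcA : bdd_on (cell k) (fun t => c t * (psi t - A)).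
  apply: bdd_onMr => //; first exact: measurable_funB.
  by have [N psiN] := bpsi; exists (N + `|A|) => t;
    rewrite (le_trans (ler_normB _ _))// lerD.
have psiA t : cell k t -> (psi t - A) ^+ 2 <= W.
  move=> ct; pose g s := c s * (psi t - psi s).
  have bg : bdd_on (cell k) g.
    apply: bdd_onMr => //; first exact: measurable_funB.
    have [N psiN] := bpsi; exists (`|psi t| + N) => s.
    by rewrite (le_trans (ler_normB _ _))// lerD.
  (* psi t - A is the average of psi t - psi s over [s] in the cell; by Cauchy-Schwarz its square is
     at most the average of the squares. *)
  have E : mesh * (psi t - A) = \int[mu1]_s (c s * g s).
    have -> : \int[mu1]_s (c s * g s) = \int[mu1]_s (psi t * c s - c s * psi s).
      by apply: eq_Rintegral => s _; rewrite /g mulrA cc; ring.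
    rewrite (bdd_intB mB fB (bdd_onZ _ bc) bcpsi) (bdd_intZ mB fB _ bc) intc.
    by rewrite -/P /A mulrBr mulrCA divff ?mulr1 ?gt_eqF// mulrC.
  have := bdd_int_CS mB fB bc bg; rewrite -E.
  have -> : \int[mu1]_s (c s ^+ 2) = mesh.
    by rewrite -intc; apply: eq_Rintegral => s _; rewrite expr2 cc.
  have : \int[mu1]_s (g s ^+ 2) <= W * mesh.
    rewrite -intc -(bdd_intZ mB fB W bc); apply: (bdd_int_le mB fB).
    - exact: bdd_onX2.
    - exact: bdd_onZ.
    move=> s; rewrite /g /c indicE; have [cs|cs] := pselect (cell k s).
      by rewrite mem_set// mul1r mulr1 psiW.
    by rewrite memNset// mul0r mulr0 expr0n.
  move=> gW H; have : mesh ^+ 2 * (psi t - A) ^+ 2 <= mesh ^+ 2 * W.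
    rewrite -exprMn (le_trans H)// expr2 -mulrA ler_pM2l//.
    by rewrite mulrC.
  by rewrite ler_pM2l// exprn_gt0.
(* Expansion around the average: the terms containing A as a factor integrate to P^2 / mesh. *)
have -> : \int[mu1]_t (c t * psi t ^+ 2) =
    \int[mu1]_t ((c t * (psi t - A)) ^+ 2 + (2 * A * (c t * psi t) - A ^+ 2 * c t)).
  by apply: eq_Rintegral => t _; rewrite exprMn (expr2 (c t)) cc; ring.
have b1 := bdd_onX2 bcA; have b2 := bdd_onZ (2 * A) bcpsi; have b3 := bdd_onZ (A ^+ 2) bc.
rewrite (bdd_intD mB fB b1 (bdd_onB b2 b3)) (bdd_intB mB fB b2 b3).
rewrite (bdd_intZ mB fB _ bcpsi) (bdd_intZ mB fB _ bc) intc -/P.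
rewrite (_ : 2 * A * P - A ^+ 2 * mesh = P ^+ 2 / mesh); last first.
  by rewrite /A; field; rewrite gt_eqF.
rewrite addrC lerD2l mulrC -intc -(bdd_intZ mB fB W bc).
apply: (bdd_int_le mB fB b1 (bdd_onZ _ bc)) => t.
rewrite /c indicE; have [ct|ct] := pselect (cell k t).
  by rewrite mem_set// mul1r mulr1 psiA.
by rewrite memNset// mul0r mulr0 expr0n.
Qed.

(** [W] varies with the cell so that it can be the energy located in that cell, to be summed
    later. *)
Lemma cells_bound (psi : R -> R) (W : nat -> R) : bdd_on (segm L) psi ->
  (forall k s t, cell k s -> cell k t -> (psi t - psi s) ^+ 2 <= W k) ->
  \int[mu1]_t (psi t ^+ 2) <= \sum_(k < M)
    ((\int[mu1]_t (\1_(cell k) t * psi t)) ^+ 2 / mesh + mesh * W k).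
Proof.
move=> bpsi psiW; have [mpsi bdpsi psi0] := bpsi.
have -> : \int[mu1]_t (psi t ^+ 2) = \int[mu1]_t (\sum_(k < M) \1_(cell k) t * psi t ^+ 2).
  apply: eq_Rintegral => t _; rewrite -mulr_suml.
  have [st|/psi0 ->] := pselect (segm L t); last by rewrite expr0n mulr0.
  by rewrite sum_indic_cell_eq1// mul1r.
rewrite (bdd_int_sum (@measurable_segm R L) (segm_fin L)); last first.
  move=> k; under eq_fun do rewrite mulrC; apply: bdd_onMr; first exact: bdd_onX2.
    exact: measurable_indic (measurable_cell k).
  by exists 1 => t; rewrite indicE; case: (_ \in _); rewrite ?normr1 ?normr0.
by apply: ler_sum => k _; apply: cell_bound => // s t; exact: psiW.
Qed.

End cells.

Section rellich.
Context (R : realType) (L : R).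
Hypothesis L0 : 0 <= L.
Local Notation T1 := (measurableTypeR R).
Local Notation mu1 := (@lebesgue_measure R).
Local Notation mu := (lebesgue_rV R).
Local Notation bddn n := (bdd_on (@box R L n)).

Lemma measurable_cell_coord n M k :
  measurable_fun setT (fun x : 'rV[R]_n.+1 => \1_(cell L M k) (x 0 0) : R).
Proof.
have mc : measurable_fun [set: T1] (\1_(cell L M k) : T1 -> R).
  by apply: measurable_indic; exact: measurable_cell.
exact: (measurableT_comp mc (measurable_coord 0)).
Qed.

(** The increment is the pairing of [h] with the integral of [df] from [s] to [t] in the first
    coordinate. Cauchy-Schwarz in [y] produces the norm of [h]; in the first coordinate it produces
    the length t - s <= mesh. *)
Lemma slice_increment n (f df : 'rV[R]_n.+1 -> R) (h : 'rV[R]_n -> R) M k (s t : R) :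
  cont_on_box L f -> cont_on_box L df ->
  (forall x, is_derive x (delta_mx 0 0) f (df x)) -> bddn n h -> (0 < M)%N ->
  cell L M k s -> cell L M k t -> s <= t ->
  (\int[mu n]_y (f (rV_cons (t, y)) * h y) - \int[mu n]_y (f (rV_cons (s, y)) * h y)) ^+ 2
  <= (\int[mu n]_y (h y ^+ 2)) *
     (mesh L M * \int[mu n.+1]_x (\1_(cell L M k) (x 0 0) * df x ^+ 2)).
Proof.
move=> cf cdf fd bh M0 ks kt st.
have mB := @measurable_box R L n; have fB := box_fin L n.
have d0 := mesh_gt0 L0 M0.
have bf := cont_on_box_bdd cf; have bdf := cont_on_box_bdd cdf.
have bft := bdd_slice_tail t bf; have bfs := bdd_slice_tail s bf.
rewrite -(bdd_intB mB fB (bdd_onM bft bh) (bdd_onM bfs bh)).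
under eq_Rintegral do rewrite -mulrBl mulrC.
have bfB := bdd_onB bft bfs.
apply: le_trans (bdd_int_CS mB fB bh bfB) _.
rewrite ler_wpM2l//; first by apply: int_ge0 => y; exact: sqr_ge0.
have bF : bddn n.+1 (fun x => \1_(cell L M k) (x 0 0) * df x ^+ 2).
  under eq_fun do rewrite mulrC; apply: bdd_onMr; first exact: bdd_onX2.
    exact: measurable_cell_coord.
  by exists 1 => x; rewrite indicE; case: (_ \in _); rewrite ?normr1 ?normr0.
rewrite (fubini_head bF) -(bdd_intZ mB fB _ (bdd_int_head bF)).
apply: (bdd_int_le mB fB (bdd_onX2 bfB) (bdd_onZ _ (bdd_int_head bF))) => y.
have mI : measurable ([set` `[s, t]] : set T1) by exact: measurable_itv.
have muI : mu1 ([set` `[s, t]] : set T1) = (t - s)%:E.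
  rewrite lebesgue_measure_itv/= lte_fin -EFinB; case: ltP => // ts.
  by have -> : s = t by [apply/eqP; rewrite eq_le st ts]; rewrite subrr.
have fI : (mu1 ([set` `[s, t]] : set T1) < +oo)%E by rewrite muI ltry.
have bI : bdd_on ([set` `[s, t]] : set T1) (\1_([set` `[s, t]]) : T1 -> R) by exact:
  (bdd_on_indic R mI).
have II r : \1_(`[s, t]) r * \1_(`[s, t]) r = \1_(`[s, t]) r :> R.
  by rewrite indicE; case: (_ \in _); rewrite ?mulr1 ?mulr0.
pose g (r : T1) := df (rV_cons (r, y)).
have bg := bdd_slice_head y bdf.
have [mg [N gN] g0] := bg.
have bIg : bdd_on ([set` `[s, t]] : set T1) (fun r => \1_(`[s, t]) r * g r).
  by apply: bdd_onMr => //; exists N.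
have -> : f (rV_cons (t, y)) - f (rV_cons (s, y)) = \int[mu1]_r (\1_(`[s, t]) r * g r).
  have [cf1 _ _] := cf; have [cdf1 _ _] := cdf; apply/esym.
  apply: (@FTC_indic _ (fun r => f (rV_cons (r, y)))) => //.
  - by move=> r; apply: continuous_comp; [exact: continuous_rV_consl|exact: cf1].
  - by move=> r; apply: continuous_comp; [exact: continuous_rV_consl|exact: cdf1].
  by move=> r; exact: is_derive_slice_head.
(* The indicator is doubled so that Cauchy-Schwarz applies to the indicator and the truncated
   [g]. *)
have -> : \int[mu1]_r (\1_(`[s, t]) r * g r) =
    \int[mu1]_r (\1_(`[s, t]) r * (\1_(`[s, t]) r * g r)).
  by apply: eq_Rintegral => r _; rewrite mulrA II.
apply: le_trans (bdd_int_CS mI fI bI bIg) _.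
apply: ler_pM.
- by apply: int_ge0 => r; exact: sqr_ge0.
- by apply: int_ge0 => r; exact: sqr_ge0.
- have -> : \int[mu1]_r (\1_(`[s, t]) r ^+ 2) = t - s.
    transitivity (\int[mu1]_r (\1_(`[s, t]) r : R)).
      by apply: eq_Rintegral => r _; rewrite expr2 II.
    by rewrite (int_indic mu1 mI); exact: (congr1 fine muI).
  move: ks kt; rewrite /cell/= !in_itv/= => /andP[ks _] /andP[_ kt].
  by rewrite -(nodeSB L M k); lra.
have bs : bdd_on (segm L) (fun r => (\1_(`[s, t]) r * g r) ^+ 2).
  apply: bdd_onX2; under eq_fun do rewrite mulrC; apply: bdd_onMr => //.
  by exists 1 => r; rewrite indicE; case: (_ \in _); rewrite ?normr1 ?normr0.
apply: (bdd_int_le (@measurable_segm R L) (segm_fin L) bs (bdd_slice_head y bF)) => r.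
rewrite rV_cons0 exprMn (expr2 (\1_ _ r)) II /=.
rewrite ler_wpM2r ?sqr_ge0// !indicE ler_nat.
have [rst|//] := boolP (r \in ([set` `[s, t]] : set T1)).
move: (set_mem rst); rewrite /= in_itv/= => /andP[sr rt].
move: ks kt; rewrite /cell/= !in_itv/= => /andP[ks _] /andP[_ kt].
by rewrite mem_set//= in_itv/= (le_trans ks sr) (le_lt_trans rt kt).
Qed.

(** In dimension 0 the space is one point of mass 1, so f^2 is the square of the pairing with the
    constant 1. *)
Lemma rellich_box0 e : 0 < e ->
  exists (I : finType) (h : I -> 'rV[R]_0 -> R) (K : R),
  [/\ 0 <= K, forall j, bddn 0 (h j) &
   forall f df, C1_on_box L f df ->
     \int[mu 0]_x (f x ^+ 2) <= e * (\sum_i \int[mu 0]_x (df i x ^+ 2)) +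
       K * (\sum_j (\int[mu 0]_x (f x * h j x)) ^+ 2)].
Proof.
move=> e0; have mB := @measurable_box R L 0; have fB := box_fin L 0.
have boxT (x : 'rV[R]_0) : box L x by case.
have bI := bdd_on_indic R mB.
exists unit, (fun _ => \1_(@box R L 0)), 1; split; [by []|by move=> _; exact: bI|move=>
  f df _].
have fE x : f x = f 0 by congr f; apply/rowP; case.
have m1 : fine (mu 0 (@box R L 0)) = 1.
  by rewrite (@lebesgue_rV_box R 0 (fun=> segm L)) ?big_ord0//; case.
rewrite [leLHS](_ : _ = \int[mu 0]_x (f 0 ^+ 2 * \1_(@box R L 0) x)); last first.
  by apply: eq_Rintegral => x _; rewrite indicE mem_set// mulr1 fE.
rewrite big_ord0 mulr0 add0r mul1r (eq_bigr (fun _ => (f 0 * 1) ^+ 2)) => [|u _].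
  by rewrite (bdd_intZ mB fB _ bI) int_indic// m1 big_const card_unit/= addr0 !mulr1.
rewrite -m1 -int_indic// -(bdd_intZ mB fB _ bI); congr (_ ^+ 2).
by apply: eq_Rintegral => x _; rewrite fE.
Qed.

(** Integrating the n-dimensional inequality over the slices leaves the squares of psi_j(t) = <f(t,
    .), h_j>. Replacing psi_j by its cell averages costs mesh^2 times the energy of the first
    partial derivative, so the same [e] serves once the mesh is fine. *)
Lemma rellich_box n e : 0 < e ->
  exists (I : finType) (h : I -> 'rV[R]_n -> R) (K : R),
  [/\ 0 <= K, forall j, bddn n (h j) &
   forall f df, C1_on_box L f df ->
     \int[mu n]_x (f x ^+ 2) <= e * (\sum_i \int[mu n]_x (df i x ^+ 2)) +
       K * (\sum_j (\int[mu n]_x (f x * h j x)) ^+ 2)].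
Proof.
elim: n e => [|n IH] e e0; first exact: rellich_box0.
have [I [h [K [K0 bh hK]]]] := IH e e0.
pose V := \sum_j \int[mu n]_y (h j y ^+ 2).
have V0 : 0 <= V by apply: sumr_ge0 => j _; apply: int_ge0 => y; exact: sqr_ge0.
have [M [M0 MK]] : exists M, (0 < M)%N /\ K * V * mesh L M ^+ 2 <= e.
  (* M > K V (2 L + 1)^2 / e together with M <= M^2 brings K V (2 L + 1)^2 / M^2 below e. *)
  exists (Num.truncn (K * V * (2 * L + 1) ^+ 2 / e)).+1; split => //.
  set M := (Num.truncn _).+1.
  have /ltW : K * V * (2 * L + 1) ^+ 2 / e < M%:R by exact: truncnS_gt.
  rewrite ler_pdivrMr// => H.
  have -> : K * V * mesh L M ^+ 2 = K * V * (2 * L + 1) ^+ 2 / M%:R ^+ 2.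
    by rewrite /mesh expr_div_n mulrA.
  rewrite ler_pdivrMr ?exprn_gt0 ?ltr0n//; apply: le_trans H _.
  by rewrite mulrC ler_pM2l// -natrX ler_nat expnS expn1 leq_pmulr.
have d0 := mesh_gt0 L0 M0.
have mB := @measurable_box R L n; have fB := box_fin L n.
have mBS := @measurable_box R L n.+1; have fBS := box_fin L n.+1.
have mS := @measurable_segm R L; have fS := segm_fin L.
have ind_bd B (t : T1) : `|\1_B t : R| <= 1.
  by rewrite indicE; case: (_ \in _); rewrite ?normr1 ?normr0.
pose tl (x : 'rV[R]_n.+1) : 'rV[R]_n := \row_i x 0 (lift 0 i).
(* Pairing with [h'] integrates psi_j over a cell. The cells reach beyond [L], hence the indicator
   of the box; it does not change the pairing because [f] vanishes off the box. *)
pose h' (p : I * 'I_M) x := \1_(@box R L n.+1) x * (\1_(cell L M p.2) (x 0 0) * h p.1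
  (tl x)).
have bh' p : bddn n.+1 (h' p).
  apply: bdd_onMr; first exact: (bdd_on_indic R mBS).
    apply: measurable_funM.
      exact: measurable_cell_coord.
    have [mh _ _] := bh p.1; apply: measurableT_comp mh _.
    apply: measurable_fun_rV => i; under eq_fun do rewrite mxE.
    exact: measurable_coord.
  have [_ [N hN] _] := bh p.1; exists (1 * N) => x.
  by rewrite normrM ler_pM.
exists (I * 'I_M)%type, h', (K / mesh L M); split=> //; first by rewrite divr_ge0// ltW.
move=> f df C1f; have [cf cdf fd] := C1f.
have bf := cont_on_box_bdd cf; have bdf i := cont_on_box_bdd (cdf i).
pose psi j (t : R) := \int[mu n]_y (f (rV_cons (t, y)) * h j y).
have bfh j : bddn n.+1 (fun x => f x * h j (tl x)).
  have [mh [N hN] _] := bh j; apply: bdd_onMr => //; last by exists N.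
  apply: measurableT_comp mh _; apply: measurable_fun_rV => i; under eq_fun do rewrite mxE.
  exact: measurable_coord.
have tlE t y : tl (rV_cons (t, y)) = y by apply/rowP => i; rewrite mxE rV_consS.
have bpsi j : bdd_on (segm L) (psi j).
  have := bdd_int_tail (bfh j); rewrite /psi.
  by under eq_fun do under eq_Rintegral do rewrite tlE.
have Efh p : \int[mu n.+1]_x (f x * h' p x) = \int[mu1]_t (\1_(cell L M p.2) t * psi p.1 t).
  rewrite (fubini_tail (bdd_onM bf (bh' p))); apply: eq_Rintegral => t _.
  rewrite /psi -(bdd_intZ mB fB _ (bdd_onM (bdd_slice_tail t bf) (bh p.1))).
  apply: eq_Rintegral => y _; rewrite /h' rV_cons0 tlE.
  have [_ _ f0] := bf; have [By|By] := pselect (@box R L n.+1 (rV_cons (t, y))).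
    by rewrite indicE mem_set// mul1r mulrCA.
  by rewrite f0// !(mul0r, mulr0).
pose E k := \int[mu n.+1]_x (\1_(cell L M k) (x 0 0) * df 0 x ^+ 2).
have sumE : \sum_(k < M) E k <= \int[mu n.+1]_x (df 0 x ^+ 2).
  have bE k : bddn n.+1 (fun x => \1_(cell L M k) (x 0 0) * df 0 x ^+ 2).
    under eq_fun do rewrite mulrC; apply: bdd_onMr; first exact: bdd_onX2.
      exact: measurable_cell_coord.
    by exists 1.
  rewrite /E -(bdd_int_sum mBS fBS)//.
  apply: (bdd_int_le mBS fBS) => [||x]; [exact: bdd_on_sum|exact: bdd_onX2|].
  by rewrite -mulr_suml ler_piMl ?sqr_ge0// sum_indic_cell_le1.
have psi_bound j : \int[mu1]_t (psi j t ^+ 2) <= \sum_(k < M)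
    ((\int[mu1]_t (\1_(cell L M k) t * psi j t)) ^+ 2 / mesh L M +
      mesh L M * ((\int[mu n]_y (h j y ^+ 2)) * (mesh L M * E k))).
  apply: (@cells_bound R L M L0 M0 (psi j) (fun k =>
    (\int[mu n]_y (h j y ^+ 2)) * (mesh L M * E k))) => //.
  move=> k s t ks kt; have [st|/ltW ts] := leP s t.
    exact: slice_increment.
  by rewrite -sqrrN opprB; exact: slice_increment.
have step : \int[mu n.+1]_x (f x ^+ 2) <=
   e * (\sum_(i < n) \int[mu n.+1]_x (df (lift 0 i) x ^+ 2)) + K * \sum_j \int[mu1]_t
     (psi j t ^+ 2).
  have bdfi i : bddn n.+1 (fun x => df (lift 0 i) x ^+ 2) by exact: bdd_onX2.
  have b1 := bdd_onZ e (bdd_on_sum (index_enum 'I_n) (fun i => bdd_int_tail (bdfi i))).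
  have b2 := bdd_onZ K (bdd_on_sum (index_enum I) (fun j => bdd_onX2 (bpsi j))).
  rewrite (fubini_tail (bdd_onX2 bf)).
  rewrite (eq_bigr _ (fun i _ => fubini_tail (bdfi i))).
  rewrite -(bdd_int_sum mS fS _ (fun i => bdd_int_tail (bdfi i))).
  rewrite -(bdd_int_sum mS fS _ (fun j => bdd_onX2 (bpsi j))).
  rewrite -(bdd_intZ mS fS _ (bdd_on_sum _ (fun i => bdd_int_tail (bdfi i)))).
  rewrite -(bdd_intZ mS fS _ (bdd_on_sum _ (fun j => bdd_onX2 (bpsi j)))).
  rewrite -(bdd_intD mS fS b1 b2).
  apply: (bdd_int_le mS fS (bdd_int_tail (bdd_onX2 bf)) (bdd_onD b1 b2)) => t.
  exact: hK (C1_slice_tail t C1f).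
(* The first partial derivative is split off: it alone has to absorb the errors of the cells. *)
apply: le_trans step _; rewrite big_ord_recl [leLHS]addrC mulrDr addrAC lerD2r.
have EV : K * \sum_j \int[mu1]_t (psi j t ^+ 2) <= K * (\sum_j \sum_(k < M)
    ((\int[mu1]_t (\1_(cell L M k) t * psi j t)) ^+ 2 / mesh L M +
      mesh L M * ((\int[mu n]_y (h j y ^+ 2)) * (mesh L M * E k)))).
  by rewrite ler_wpM2l//; apply: ler_sum.
have ES : \sum_p (\int[mu n.+1]_x (f x * h' p x)) ^+ 2 =
    \sum_j \sum_(k < M) (\int[mu1]_t (\1_(cell L M k) t * psi j t)) ^+ 2.
  by rewrite pair_bigA; apply: eq_bigr => p _; rewrite Efh.
rewrite ES [leRHS]addrC (le_trans EV)//.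
under eq_bigr do rewrite big_split/=.
rewrite big_split/= mulrDr lerD//.
  rewrite -mulrA [_^-1 * _]mulrC mulr_suml ler_wpM2l// ler_sum// => j _.
  by rewrite mulr_suml.
have -> : \sum_j \sum_(k < M) mesh L M * (\int[mu n]_y h j y ^+ 2 * (mesh L M * E k)) =
    V * (mesh L M ^+ 2 * \sum_(k < M) E k).
  rewrite /V mulr_suml; apply: eq_bigr => j _; rewrite !mulr_sumr.
  by apply: eq_bigr => k _; ring.
rewrite (_ : K * _ = (K * V * mesh L M ^+ 2) * \sum_(k < M) E k); last by rewrite !mulrA.
rewrite ler_pM//.
  exact: (mulr_ge0 (mulr_ge0 K0 V0) (sqr_ge0 _)).
apply: sumr_ge0 => k _; apply: int_ge0 => x.
by rewrite mulr_ge0 ?sqr_ge0// indicE.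
Qed.

End rellich.

(** * Test functions *)

Section test_function_theory.
Context (R : realType) (n : nat).
Implicit Types (f g : 'rV[R]_n -> R) (Omega : set 'rV[R]_n).

Lemma norm_entry_le (x : 'rV[R]_n) i : `|x 0 i| <= `|x|.
Proof.
by rewrite [leRHS]/Num.norm /= mx_normrE; apply/bigmax_geP; right => /=; exists (0, i).
Qed.

Lemma bounded_set_box Omega : bounded_set Omega ->
  exists L : R, 0 <= L /\ Omega `<=` box L (n := n).
Proof.
move=> [M [_ MO]]; exists (`|M| + 1); split; first by rewrite addr_ge0.
move=> x Ox i; rewrite in_itv/= -ler_norml (le_trans (norm_entry_le _ _))//.
by apply: MO Ox; rewrite (le_lt_trans (ler_norm M))// ltrDl.
Qed.

Lemma test_function_supp0 Omega f x : test_function Omega f -> ~ Omega x -> f x = 0.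
Proof.
move=> [_ _ fO] Ox; apply: contrapT => /eqP fx; apply: Ox; apply: fO.
exact: subset_closure.
Qed.

Lemma partial_supp0 f i x : ~ closure [set x | f x != 0] x -> partial i f x = 0.
Proof.
move=> xf; rewrite /partial (@near_eq_derive _ _ _ _ (cst 0)) ?derive_cst//.
have : nbhs x (~` closure [set x | f x != 0]).
  by apply: open_nbhs_nbhs; split => //; apply: closed_openC; exact: closed_closure.
apply: filterS => y yf; apply: contrapT => /eqP fy; apply: yf.
exact: subset_closure.
Qed.

Lemma compact_supp_bounded (K : set 'rV[R]_n) f : continuous f -> compact K ->
  (forall x, ~ K x -> f x = 0) -> exists M, forall x, `|f x| <= M.
Proof.
move=> cf cK fK; have /compact_bounded[M [_ MK]] : compact (f @` K).
  by apply: continuous_compact => //; exact: continuous_subspaceT.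
exists (`|M| + 1) => x; have [Kx|/fK ->] := pselect (K x).
  apply: MK; last by exists x.
  by rewrite (le_lt_trans (ler_norm M))// ltrDl.
by rewrite normr0 addr_ge0.
Qed.

Lemma test_function_C1 Omega f L : test_function Omega f ->
  closure [set x | f x != 0] `<=` box L (n := n) ->
  C1_on_box L f (fun i => partial i f).
Proof.
move=> [sf cf fO] KL.
have f0 x : ~ closure [set x | f x != 0] x -> f x = 0.
  by move=> xf; apply: contrapT => /eqP fx; apply: xf; exact: subset_closure.
have [cf0 df0] := sf [::].
split.
- split => //; first exact: compact_supp_bounded cf0 cf f0.
  by move=> x xL; apply: f0 => /KL.
- move=> i; have [cfi _] := sf [:: i]; split => //.
    by apply: (compact_supp_bounded cfi cf) => x; exact: partial_supp0.
  by move=> x xL; apply: partial_supp0 => /KL.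
by move=> i x; apply: DeriveDef => //; exact: df0.
Qed.

(** The cube depends on the function. This suffices where [L] does not enter the constants, as for
    integration by parts and Poincaré on an unbounded Omega; [grad_c_rellich] takes one cube for all
    of Omega. *)
Lemma test_function_box Omega f : test_function Omega f -> exists L,
  C1_on_box L f (fun i => partial i f).
Proof.
move=> tf; have [_ cf _] := tf.
have [L [_ fL]] := bounded_set_box (compact_bounded cf).
by exists L; exact: test_function_C1 tf fL.
Qed.

Lemma test_function0 Omega : test_function Omega (fun=> 0).
Proof.
have p0 s : foldr (@partial R n) (fun=> 0) s = fun=> 0.
  elim: s => //= i s ->; apply/funext => x; exact: derive_cst.
split.
- move=> s; rewrite p0; split=> [|i x]; first exact: cst_continuous.
  exact: derivable_cst.
- rewrite (_ : [set _ | _] = set0) ?closure0; first exact: compact0.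
  by rewrite -subset0 => x /=; rewrite eqxx.
rewrite (_ : [set _ | _] = set0) ?closure0//.
by rewrite -subset0 => x /=; rewrite eqxx.
Qed.

Lemma partial_lin a f g i : (forall x, derivable f x (delta_mx 0 i)) ->
  (forall x, derivable g x (delta_mx 0 i)) ->
  partial i (fun x => a * f x + g x) = fun x => a * partial i f x + partial i g x.
Proof.
move=> df dg; apply/funext => x.
have := @deriveD _ _ _ (a \*: f) g x (delta_mx 0 i) (derivableZ (k := a) (df x)) (dg x).
by rewrite deriveZ.
Qed.

Lemma test_function_lin Omega a f g : test_function Omega f -> test_function Omega g ->
  test_function Omega (fun x => a * f x + g x).
Proof.
move=> [sf cf fO] [sg cg gO].
have pE s : foldr (@partial R n) (fun x => a * f x + g x) s =
    fun x => a * foldr (@partial R n) f s x + foldr (@partial R n) g s x.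
  elim: s => //= i s ->; apply: partial_lin => x.
    by have [_] := sf s; exact.
  by have [_] := sg s; exact.
have sub : closure [set x | a * f x + g x != 0] `<=`
    closure [set x | f x != 0] `|` closure [set x | g x != 0].
  rewrite -closureU; apply: closureS => x /=.
  have [->|] := eqVneq (f x) 0; last by left.
  by rewrite mulr0 add0r; right.
split.
- move=> s; rewrite pE; have [cfs dfs] := sf s; have [cgs dgs] := sg s; split.
    move=> x; apply: (@continuousD _ _ _ (fun x => a * _)); last exact: cgs.
    by apply: continuousM; [exact: cst_continuous|exact: cfs].
  by move=> i x; exact: derivableD (derivableZ (k := a) (dfs i x)) (dgs i x).
- apply: subclosed_compact sub; first exact: closed_closure.
  exact: compactU.
by move=> x /sub[/fO|/gO].
Qed.

End test_function_theory.

(** * Passage between Omega and the whole space *)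

Section lebesgue_on_theory.
Context (R : realType) (n : nat) (Omega : set 'rV[R]_n) (oOmega : open Omega).
Local Notation mu := (lebesgue_on oOmega).
Local Notation L2 := (L2 oOmega).

(** Brings inner products of L2(Omega) to Lebesgue measure on R^n, where the estimates on cubes are
    proved. *)
Lemma Rintegral_lebesgue_on (f : 'rV[R]_n -> R) : (forall x, ~ Omega x -> f x = 0) ->
  \int[mu]_x f x = \int[lebesgue_rV R n]_x f x.
Proof.
move=> f0; have fE : f = f \_ Omega.
  by apply/funext => x; rewrite patchE; case: ifPn => //; rewrite notin_setE => /f0.
rewrite fE -!Rintegral_mkcond; congr fine; apply: eq_measure_integral => A mA AO.
transitivity (lebesgue_rV R n (A `&` Omega)); [by []|by rewrite setIidl].
Qed.

Lemma inner_lebesgue_on (u v : L2) (f g : 'rV[R]_n -> R) :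
  measurable_fun setT f -> measurable_fun setT g ->
  L2fun u = f %[ae mu] -> L2fun v = g %[ae mu] -> (forall x, ~ Omega x -> f x = 0) ->
  inner u v = \int[lebesgue_rV R n]_x (f x * g x).
Proof.
move=> mf mg uf vg f0; rewrite (L2_innerE_ae mf mg uf vg) Rintegral_lebesgue_on//.
by move=> x /f0 ->; rewrite mul0r.
Qed.

Lemma bdd_on_L2 (h : 'rV[R]_n -> R) L : bdd_on (box L (n := n)) h ->
  h \in Lfun mu 2%:E.
Proof.
move=> bh; have [mh _ _] := bh; apply: Lfun2P => //.
have mB := @measurable_box R L n.
have fB : (mu (box L (n := n)) < +oo)%E.
  apply: le_lt_trans (box_fin L n); rewrite /lebesgue_on /mrestr/=.
  apply: le_measure; [rewrite inE; apply: measurableI => //;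
    exact: open_measurable_rV|by rewrite inE|exact: subIsetl].
have /integrableP[_] := bdd_on_integrable mB fB (bdd_onX2 bh).
by under eq_integral do rewrite /= ger0_norm ?sqr_ge0//.
Qed.

End lebesgue_on_theory.

(** * Closures of grad_c and div_c *)

Section closure_facts.
Context (R : realType).

Lemma closure_sub_closed (T : topologicalType) (A P : set T) : closed P -> A `<=` P ->
  closure A `<=` P.
Proof. by move=> /closure_id cP /closureS; rewrite -cP. Qed.

(** One argument at a time: first [q] runs through the closure with [p] in [A], then [p] does with
    [q] fixed in the closure. *)
Lemma closure_lin (Z : normedModType R) (A : set Z) :
  (forall (a : R) p q, A p -> A q -> A (a *: p + q)) ->
  forall (a : R) p q, closure A p -> closure A q -> closure A (a *: p + q).
Proof.
move=> AL a p q Ap Aq.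
have closed_pre (F : Z -> Z) : continuous F -> closed (F @^-1` closure A).
  by move=> /continuous_closedP; apply; exact: closed_closure.
have step r : A r -> closure A `<=` (fun s => a *: r + s) @^-1` closure A.
  move=> Ar; apply: closure_sub_closed.
    by apply: closed_pre => s; apply: cvgD; [exact: cvg_cst|exact: cvg_id].
  by move=> s As; apply: subset_closure; exact: AL.
suff : closure A `<=` (fun r => a *: r + q) @^-1` closure A by exact.
apply: closure_sub_closed; last by move=> r /step; exact.
by apply: closed_pre => s; apply: cvgD; [apply: cvgZr; exact: cvg_id|exact: cvg_cst].
Qed.

Context (X Y : innerProductType R).
Implicit Types G : set (X * Y).

(** The identity is a closed condition on either pair when the other is fixed, so [G] and [D] are
    closed up one after the other. *)
Lemma closure_dual G D : (forall v g Psi d, G (v, g) -> D (Psi, d) -> inner d v = -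
  inner Psi g) ->
  forall v g Psi d, closure G (v, g) -> closure D (Psi, d) -> inner d v = - inner Psi g.
Proof.
move=> GD.
have cl (x : X) (y : Y) : closed [set p : X * Y | inner x p.1 + inner y p.2 = 0].
  have /continuous_closedP : continuous (fun p : X * Y => inner x p.1 + inner y p.2).
    move=> p; apply: cvgD.
      by apply: (@continuous_comp _ _ _ (@fst X Y) (inner x));
        [exact: cvg_fst|exact: continuous_innerr].
    by apply: (@continuous_comp _ _ _ (@snd X Y) (inner y));
      [exact: cvg_snd|exact: continuous_innerr].
  by move=> /(_ _ (@closed_eq _ 0)).
have cl' (x : X) (y : Y) : closed [set p : Y * X | inner p.2 x + inner p.1 y = 0].
  have /continuous_closedP : continuous (fun p : Y * X => inner p.2 x + inner p.1 y).
    move=> p; apply: cvgD.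
      by apply: (@continuous_comp _ _ _ (@snd Y X) (fun z => inner z x));
        [exact: cvg_snd|exact: continuous_innerl].
    by apply: (@continuous_comp _ _ _ (@fst Y X) (fun z => inner z y));
      [exact: cvg_fst|exact: continuous_innerl].
  by move=> /(_ _ (@closed_eq _ 0)).
have step q : D q -> closure G `<=` [set p : X * Y | inner q.2 p.1 + inner q.1 p.2 = 0].
  case: q => Psi d Dq; apply: closure_sub_closed => // -[v g] Gv /=.
  by rewrite (GD _ _ _ _ Gv Dq) addNr.
move=> v g Psi d Gv Dd; apply/eqP; rewrite -addr_eq0; apply/eqP.
suff : closure D `<=` [set p : Y * X | inner p.2 v + inner p.1 g = 0] by move=> /(_ _ Dd).
by apply: closure_sub_closed => // q Dq; exact: (step q Dq _ Gv).
Qed.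

Lemma closure_poincare G C : (forall v g, G (v, g) -> `|v| <= C * `|g|) ->
  forall v g, closure G (v, g) -> `|v| <= C * `|g|.
Proof.
move=> GC v g; suff : closure G `<=` [set p : X * Y | `|p.1| - C * `|p.2| <= 0].
  by move=> /[apply]; rewrite /= subr_le0.
apply: closure_sub_closed => [|[w k] /GC]; last by rewrite /= subr_le0.
have /continuous_closedP : continuous (fun p : X * Y => `|p.1| - C * `|p.2|).
  move=> p; apply: cvgB; first by apply: cvg_norm; exact: cvg_fst.
  by apply: cvgM; [exact: cvg_cst|apply: cvg_norm; exact: cvg_snd].
by move=> /(_ _ (@closed_le _ 0)).
Qed.

Lemma closure_rellich G e K (I : finType) (h : I -> X) :
  (forall v g, G (v, g) -> `|v| ^+ 2 <= e * `|g| ^+ 2 + K * \sum_i inner v (h i) ^+ 2) ->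
  forall v g, closure G (v, g) -> `|v| ^+ 2 <= e * `|g| ^+ 2 + K * \sum_i inner v (h i)
    ^+ 2.
Proof.
move=> GC v g; pose F (p : X * Y) := `|p.1| ^+ 2 - (e * `|p.2| ^+ 2 + K * \sum_i inner
  p.1 (h i) ^+ 2).
suff : closure G `<=` [set p : X * Y | F p <= 0].
  by move=> /[apply]; rewrite /= subr_le0.
apply: closure_sub_closed => [|[w k] /GC]; last by rewrite /= subr_le0.
have n1 : continuous (fun p : X * Y => `|p.1|) by move=> p; apply: cvg_norm; exact: cvg_fst.
have n2 : continuous (fun p : X * Y => `|p.2|) by move=> p; apply: cvg_norm; exact: cvg_snd.
have nh i : continuous (fun p : X * Y => inner p.1 (h i) ^+ 2).
  have c1 : continuous (fun p : X * Y => inner p.1 (h i)).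
    by move=> p; apply: (@continuous_comp _ _ _ (@fst X Y) (fun z => inner z (h i)));
      [exact: cvg_fst|exact: continuous_innerl].
  by move=> p; apply: cvgM; exact: c1.
have /continuous_closedP : continuous F.
  move=> p; apply: cvgB; first by apply: cvgM; exact: n1.
  apply: cvgD; apply: cvgM; try exact: cvg_cst; first by apply: cvgM; exact: n2.
  exact: (continuous_sum (s := index_enum I) nh).
by move=> /(_ _ (@closed_le _ 0)).
Qed.

End closure_facts.

(** * Linearity, duality and estimates for test functions *)

Section grad_div_facts.
Context (R : realType) (n : nat) (Omega : set 'rV[R]_n) (oOmega : open Omega).
Local Notation mu := (lebesgue_on oOmega).
Local Notation L2 := (L2 oOmega).
Local Notation L2n := {ffun 'I_n -> L2}.
Local Notation leb := (lebesgue_rV R n).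

Lemma grad_c0 : grad_c oOmega (0, 0).
Proof.
exists (fun=> 0); split; first exact: test_function0.
  exact: L2fun0.
move=> j; rewrite /= ffunE (_ : partial j _ = fun=> 0); first exact: L2fun0.
by apply/funext => x; exact: derive_cst.
Qed.

Lemma div_c0 : div_c oOmega (0, 0).
Proof.
exists (fun _ _ => 0); split; first by move=> j; exact: test_function0.
  by move=> j; rewrite ffunE; exact: L2fun0.
apply: filterS (@L2fun0 _ _ R mu) => x H _; have := H I; rewrite /L2fun/= => ->.
by rewrite big1// => j _; rewrite /partial derive_cst.
Qed.

Lemma grad_c_lin (a : R) (p q : L2 * L2n) : grad_c oOmega p -> grad_c oOmega q ->
  grad_c oOmega (a *: p + q).
Proof.
case: p q => [v g] [v' g'] [f [tf vf gf]] [f' [tf' vf' gf']].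
have lin (u u' : L2) k k' : L2fun u = k %[ae mu] -> L2fun u' = k' %[ae mu] ->
    L2fun (a *: u + u') = (fun x => a * k x + k' x) %[ae mu].
  move=> uk uk'; apply: filterS4 (L2funD (a *: u) u') (L2funZ a u) uk uk' => x.
  move=> + + + + _ => /(_ I) + /(_ I) + /(_ I) + /(_ I).
  by rewrite /L2fun => -> -> -> ->.
exists (fun x => a * f x + f' x); split; first exact: test_function_lin.
  exact: lin.
move=> j; have [[sf _ _] [sf' _ _]] := (tf, tf').
rewrite partial_lin => [|x|x]; last 2 first.
  - by have [_] := sf [::]; exact.
  - by have [_] := sf' [::]; exact.
by rewrite /= !ffunE; exact: lin.
Qed.

Lemma test_function_measurable f : test_function Omega f -> measurable_fun setT f.
Proof. by move=> [sf _ _]; apply: continuous_measurable_rV; have [] := sf [::]. Qed.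

Lemma partial_measurable f i : test_function Omega f -> measurable_fun setT (partial i f).
Proof. by move=> [sf _ _]; apply: continuous_measurable_rV; have [] := sf [:: i]. Qed.

Lemma partial_out f i x : test_function Omega f -> ~ Omega x -> partial i f x = 0.
Proof. by move=> [_ _ fO] Ox; apply: partial_supp0 => /fO. Qed.

Lemma grad_c_norm (v : L2) (g : L2n) f : test_function Omega f ->
  L2fun v = f %[ae mu] -> (forall j, L2fun (g j) = partial j f %[ae mu]) ->
  `|v| ^+ 2 = \int[leb]_x (f x ^+ 2) /\
  `|g| ^+ 2 = \sum_j \int[leb]_x (partial j f x ^+ 2).
Proof.
move=> tf vf gf; have mf := test_function_measurable tf; split.
  by rewrite -inner_norm (inner_lebesgue_on mf mf vf vf)// => x;
    exact: test_function_supp0 tf.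
rewrite sqr_norm_ffun; apply: eq_bigr => j _; have mj := partial_measurable j tf.
by rewrite -inner_norm (inner_lebesgue_on mj mj (gf j) (gf j))// => x;
  exact: partial_out tf.
Qed.

(** For each j, the j-th derivative of the product of f and the j-th component has integral 0; a
    cube around the support of f contains that of the product. *)
Lemma grad_c_div_c_dual v g Psi d : grad_c oOmega (v, g) -> div_c oOmega (Psi, d) ->
  inner d v = - inner Psi g.
Proof.
move=> [f [tf /= vf gf]] [P [tP /= PsiP dP]].
have [L [cf cdf fd]] := test_function_box tf.
have mf := test_function_measurable tf.
have mB := @measurable_box R L n; have fB := box_fin L n.
have bf := cont_on_box_bdd cf.
have mdP : measurable_fun setT (fun x => \sum_j partial j (P j) x).
  by apply: measurable_sum => j; exact: partial_measurable.
rewrite innerC (inner_lebesgue_on mf mdP vf dP) => [|x]; last exact: test_function_supp0 tf.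
have cP j : continuous (P j) /\ exists M, forall x, `|P j x| <= M.
  by have [L' [[cP bP _] _ _]] := test_function_box (tP j).
have cdP j : continuous (partial j (P j)) /\ exists M, forall x, `|partial j (P j) x| <= M.
  by have [L' [_ /(_ j)[cdP bdP _] _]] := test_function_box (tP j).
have b1 j : bdd_on (box L (n := n)) (fun x => f x * partial j (P j) x).
  apply: bdd_onMr => //; last exact: (cdP j).2.
  exact: partial_measurable.
have b2 j : bdd_on (box L (n := n)) (fun x => P j x * partial j f x).
  under eq_fun do rewrite mulrC; apply: bdd_onMr; last exact: (cP j).2.
    exact: cont_on_box_bdd.
  exact: test_function_measurable (tP j).
rewrite inner_ffunE -sumrN.
rewrite (_ : \int[leb]_x _ = \int[leb]_x (\sum_j f x * partial j (P j) x)); last first.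
  by apply: eq_Rintegral => x _; rewrite mulr_sumr.
rewrite (bdd_int_sum mB fB)//; apply: eq_bigr => j _.
rewrite (inner_lebesgue_on (test_function_measurable (tP j)) (partial_measurable j tf)
  (PsiP j) (gf j)); last first.
  by move=> x; exact: test_function_supp0 (tP j).
apply/eqP; rewrite -addr_eq0 -(bdd_intD mB fB (b1 j) (b2 j)); apply/eqP.
apply: (@int_partial0 _ L n (fun x => f x * P j x) _ j).
- apply: cont_on_boxM => //; first exact: (cP j).1.
  by have [M PM] := (cP j).2; exists M => x _.
- apply: cont_on_boxD.
    apply: cont_on_boxM => //; first exact: (cdP j).1.
    by have [M PM] := (cdP j).2; exists M => x _.
  under eq_fun do rewrite mulrC; apply: cont_on_boxM => //; first exact: (cP j).1.
  by have [M PM] := (cP j).2; exists M => x _.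
move=> x; have [L' [_ _ Pd]] := test_function_box (tP j).
exact: is_derive_eq (is_deriveM (fd j x) (Pd j x)) _.
Qed.

Lemma grad_c_poincare x m v g : dotR x x = 1 -> Omega `<=` [set y | `|dotR y x| <= m] ->
  0 <= m -> grad_c oOmega (v, g) -> `|v| <= 2 * m * `|g|.
Proof.
move=> xx Om m0 [f [tf /= vf gf]]; have [vE gE] := grad_c_norm tf vf gf.
have [L fL] := test_function_box tf.
rewrite -ler_sqr ?nnegrE ?mulr_ge0// !exprMn vE gE -natrX.
apply: poincare_C1 fL xx _ => y fy; apply: Om.
by apply: contrapT => /(test_function_supp0 tf)/eqP; rewrite (negbTE fy).
Qed.

(** The functions [h] live on the cube and are restricted to Omega; the pairings are unchanged since
    test functions vanish outside Omega. *)
Lemma grad_c_rellich e : bounded_set Omega -> 0 < e ->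
  exists (I : finType) (h : I -> L2) (K : R), forall v g, grad_c oOmega (v, g) ->
    `|v| ^+ 2 <= e * `|g| ^+ 2 + K * \sum_i inner v (h i) ^+ 2.
Proof.
move=> /bounded_set_box[L [L0 OL]] e0.
have [I [h [K [K0 bh hK]]]] := rellich_box L0 n e0.
exists I, (fun i => toL2 (bdd_on_L2 oOmega (bh i))), K => v g [f [tf /= vf gf]].
have [vE gE] := grad_c_norm tf vf gf; rewrite vE gE.
have fL : C1_on_box L f (fun i => partial i f).
  by have [_ _ fO] := tf; apply: test_function_C1 (tf) _; exact: subset_trans OL.
apply: le_trans (hK _ _ fL) _; rewrite lerD2l ler_wpM2l//; apply: ler_sum => i _.
have [mh _ _] := bh i.
rewrite (inner_lebesgue_on (test_function_measurable tf) mh vf (toL2K _))//.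
by move=> x; exact: test_function_supp0 tf.
Qed.

End grad_div_facts.

Unset Implicit Arguments.

Theorem theorem5p1 (R : realType) (n : nat) (Omega : set 'rV[R]_n)
    (oOmega : open Omega) :
  (exists (x : 'rV[R]_n) (m : R),
    [/\ euclidean_norm x = 1, 0 < m &
        Omega `<=` [set y | `|dotR y x| <= m]]) ->
  [/\ closed (op_ran (grad_sharp oOmega)),
      grad_sharp oOmega = op_opp (op_adj (div_sharp oOmega)) &
      bounded_set Omega ->
        compact_embedding (op_red (grad_sharp oOmega)) /\
        compact_embedding (op_red (div_sharp oOmega))].
Proof.
move=> [x [m [x1 m0 Om]]].
have xx : dotR x x = 1.
  have d0 : 0 <= dotR x x by apply: sumr_ge0 => i _; rewrite -expr2 sqr_ge0.
  by rewrite -(sqr_sqrtr d0) -[Num.sqrt _]/(euclidean_norm x) x1 expr1n.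
have hX := @L2_complete _ _ R (lebesgue_on oOmega).
have hY := ffun_complete (n := n) hX.
have cG : closed (grad_0 oOmega) by exact: closed_closure.
have G00 : grad_0 oOmega (0, 0) by apply: subset_closure; exact: grad_c0.
have D00 : div_0 oOmega (0, 0) by apply: subset_closure; exact: div_c0.
have GL a v g v' g' : grad_0 oOmega (v, g) -> grad_0 oOmega (v', g') ->
    grad_0 oOmega (a *: v + v', a *: g + g').
  exact: (closure_lin (@grad_c_lin R n Omega oOmega)).
have dual := closure_dual (@grad_c_div_c_dual R n Omega oOmega).
have poinc := closure_poincare (fun v g => @grad_c_poincare R n Omega oOmega x m v g xx
  Om (ltW m0)).
have C0 : 0 <= 2 * m by rewrite mulr_ge0// ltW.
split.
- exact: (grad_sharp_ran_closed hX cG GL dual C0 poinc).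
- exact: (grad_sharp_adj hX hY cG G00 GL D00 dual C0 poinc).
move=> bO.
(* [h] and [K] found for [grad_c] are kept for its closure. *)
have rel e : 0 < e -> exists (I : finType) (h : I -> _) (K : R), forall v g,
    grad_0 oOmega (v, g) -> `|v| ^+ 2 <= e * `|g| ^+ 2 + K * \sum_i inner v (h i) ^+ 2.
  move=> /(grad_c_rellich oOmega bO)[I [h [K hK]]].
  by exists I, h, K; exact: closure_rellich hK.
split.
- exact: (grad_sharp_red_compact hX cG G00 GL dual C0 poinc rel).
exact: (div_sharp_red_compact hX hY cG G00 GL D00 C0 poinc rel).
Qed.
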